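(* Let $q$ be a prime power, let $\mathbb{F}_q$ be the finite field of $q$ elements, and let $a,b,c,f,g\in\mathbb{F}_q^*$. Given $q,a,b,c,f,g$ as input, one can either find a solution $(x,y)$ in nonnegative integers $x,y\in\mathbb{Z}_{\geq 0}$ of the equation $af^x+bg^y=c$ over $\mathbb{F}_q$, or decide that this equation has no solution, in deterministic time $q^{9/8}(\log q)^{O(1)}$ on a classical computer.
   Context: $\mathbb{F}_q^*$ denotes the multiplicative group of nonzero elements of $\mathbb{F}_q$. The implied constant in $O(1)$ is absolute: a single algorithm works for all $q,a,b,c,f,g$ with a uniform time bound. The input size is of order $\log q$. *)

(* Defs.v *)
From mathcomp Require Import all_boot all_order all_algebra.
From mathcomp Require Import qpoly qfpoly.
From mathcomp Require Import reals exp.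

Set Implicit Arguments.
Unset Strict Implicit.
Unset Printing Implicit Defensive.

Import GRing.Theory Num.Theory.

(* Model of computation: a deterministic random access machine with a finite
   program, registers X_0, X_1, ... holding natural numbers (all initially 0),
   a read-only input tape and a write-only output tape, and logarithmic cost:
   every access to a register is charged the bit lengths of its index and of
   its contents, and multiplication and division are moreover charged the
   product of the bit lengths of the operands (schoolbook arithmetic). *)

Inductive instr : Type :=
| Const of nat & nat
| Add of nat & nat & nat
| Sub of nat & nat & nat
| Mul of nat & nat & nat
| Div of nat & nat & nat
| Fetch of nat & nat
| Store of nat & nat
| JumpPos of nat & nat
| Read of nat
| Write of nat.

Definition program := seq instr.

Record config := Config {
  pc : nat;
  mem : nat -> nat;
  inp : seq nat;
  out : seq nat
}.

Definition upd (m : nat -> nat) (i v : nat) : nat -> nat :=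
  fun k => if k == i then v else m k.

Definition step (I : instr) (s : config) : config :=
  let: Config l m u w := s in
  match I with
  | Const i c => Config l.+1 (upd m i c) u w
  | Add i j k => Config l.+1 (upd m i (m j + m k)) u w
  | Sub i j k => Config l.+1 (upd m i (m j - m k)) u w
  | Mul i j k => Config l.+1 (upd m i (m j * m k)) u w
  | Div i j k => Config l.+1 (upd m i (m j %/ m k)) u w
  | Fetch i j => Config l.+1 (upd m i (m (m j))) u w
  | Store i j => Config l.+1 (upd m (m i) (m j)) u w
  | JumpPos i l' => Config (if 0 < m i then l' else l.+1) m u w
  | Read i => Config l.+1 (upd m i (head 0 u)) (behead u) w
  | Write i => Config l.+1 m u (rcons w (m i))
  end.

(* The number of binary digits of v; one digit for v = 0. *)
Definition bits (v : nat) : nat := (trunc_log 2 v).+1.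

(* One access to register i, which holds or receives v. *)
Definition acc (i v : nat) : nat := bits i + bits v.

Definition cost (I : instr) (s : config) : nat :=
  let: Config _ m u _ := s in
  match I with
  | Const i c => acc i c
  | Add i j k => acc j (m j) + acc k (m k) + acc i (m j + m k)
  | Sub i j k => acc j (m j) + acc k (m k) + acc i (m j - m k)
  | Mul i j k => acc j (m j) + acc k (m k) + acc i (m j * m k)
                 + bits (m j) * bits (m k)
  | Div i j k => acc j (m j) + acc k (m k) + acc i (m j %/ m k)
                 + bits (m j) * bits (m k)
  | Fetch i j => acc j (m j) + acc (m j) (m (m j)) + acc i (m (m j))
  | Store i j => acc i (m i) + acc j (m j) + acc (m i) (m j)
  | JumpPos i _ => acc i (m i)
  | Read i => acc i (head 0 u)
  | Write i => acc i (m i)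
  end.

(* [runs P s t w]: started in s, program P halts (its program counter leaves
   the program) after time t with output tape w. *)
Inductive runs (P : program) : config -> nat -> seq nat -> Prop :=
| runs_halt s : onth P (pc s) = None -> runs P s 0 (out s)
| runs_step s I t w : onth P (pc s) = Some I ->
    runs P (step I s) t w -> runs P s (cost I s + t) w.

Definition init (u : seq nat) : config := Config 0 (fun=> 0) u [::].

Definition computes_in (P : program) (u w : seq nat) (t : nat) : Prop :=
  runs P (init u) t w.

(* The field with q = p ^ n elements is handed to the machine as
   F_p[X]/(h), h monic irreducible of degree n over F_p; field elements are
   handed over as their n coefficients in 0, ..., p - 1 in the basis
   1, X, ..., X^(n-1), lowest degree first. *)
Definition coeffs (p n : nat) (r : {poly 'F_p}) : seq nat :=
  mkseq (fun i => nat_of_ord (r`_i)%R) n.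

(* h is given by its n + 1 coefficients, including the leading 1. *)
Definition encode_input (q p n : nat) (h : {poly 'F_p})
    (hI : monic_irreducible_poly h)
    (a b c f g : {poly %/ h with hI}) : seq nat :=
  [:: q; p; n] ++ coeffs n.+1 h ++ coeffs n a ++ coeffs n b ++ coeffs n c
    ++ coeffs n f ++ coeffs n g.

Definition encode_answer (r : option (nat * nat)) : seq nat :=
  if r is Some (x, y) then [:: 1; x; y] else [:: 0].

Definition correct_answer (F : fieldType) (a b c f g : F)
    (r : option (nat * nat)) : Prop :=
  match r with
  | Some (x, y) => (a * f ^+ x + b * g ^+ y = c)%R
  | None => ~ exists x y : nat, (a * f ^+ x + b * g ^+ y = c)%R
  end.

(* Main.v *)
Require Import Defs.
From mathcomp Require Import all_boot all_order all_algebra.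
From mathcomp Require Import polydiv qpoly finfield qfpoly zify ring.
From mathcomp Require Import reals exp.
Import GRing.Theory Num.Theory Pdiv.CommonRing Pdiv.RingMonic.

(** Only time is bounded, not space, so one may tabulate the values
    [b * g ^ y] for all [y < q] in an array indexed by the field elements, which
    replaces every discrete logarithm by one look-up. Since exponents only
    matter modulo [q - 1], it then suffices to look up [c - a * f ^ x] for all
    [x < q], so that O(q) field operations decide the equation, well within
    the bound [q ^ (9 / 8)].

    A field element is stored as the base-[p] number of its coefficients. All
    field operations are built from [R + s V] computed digitwise modulo [p]:
    multiplication by [X] is a shift followed by subtracting the top digit times
    the modulus, and a product is evaluated along the digits of one factor. All
    numbers met are at most [q ^ 16], so each instruction costs
    [O((log q) ^ 2)] and each field operation takes [O((log q) ^ 2)]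
    instructions. *)

Set Implicit Arguments.
Unset Strict Implicit.
Unset Printing Implicit Defensive.

(** * Structured programs and their cost *)

Definition store := ((nat -> nat) * seq nat)%type.

(** A store omits the program counter and the output tape. A [simple] instruction only increments
    the former and leaves the latter alone, so dummy values serve for both. *)
Definition eff (I : instr) (s : store) : store :=
  let s' := step I (Config 0 s.1 s.2 [::]) in (Defs.mem s', inp s').

Definition effs (l : seq instr) (s : store) : store :=
  foldl (fun s I => eff I s) s l.

(** Literal register indices stay at most 64 so that their bit length is absorbed by that of the
    bound [M]; higher cells are reached only through [Fetch] and [Store]. *)
Definition simple (I : instr) : bool :=
  match I with
  | Const i _ | Read i => i <= 64
  | Add i j k | Defs.Sub i j k | Mul i j k | Div i j k =>
      [&& i <= 64, j <= 64 & k <= 64]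
  | Fetch i j | Store i j => (i <= 64) && (j <= 64)
  | JumpPos _ _ | Write _ => false
  end.

(** [Loop] tests its register after the body, which therefore runs at least once. There is no
    conditional; address arithmetic replaces it in the search. *)
Inductive cmd :=
| Do of seq instr
| Seq of cmd & cmd
| Loop of cmd & nat.

Fixpoint code_size (c : cmd) : nat :=
  match c with
  | Do l => size l
  | Seq c1 c2 => code_size c1 + code_size c2
  | Loop c _ => (code_size c).+1
  end.

Fixpoint compile (l : nat) (c : cmd) : program :=
  match c with
  | Do s => s
  | Seq c1 c2 => compile l c1 ++ compile (l + code_size c1) c2
  | Loop c r => rcons (compile l c) (JumpPos r l)
  end.

Lemma size_compile (l : nat) (c : cmd) : size (compile l c) = code_size c.
Proof.
by elim: c l => [s|c1 IH1 c2 IH2|c IH r] l //=;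
  rewrite ?size_cat ?size_rcons ?IH1 ?IH2 ?IH.
Qed.

Section Bounded.
Variable M : nat.

(* The only instructions that can push a value above the bound [M]. *)
Definition safe (I : instr) (s : store) : bool :=
  match I with
  | Const _ c => c <= M
  | Add _ j k => s.1 j + s.1 k <= M
  | Mul _ j k => s.1 j * s.1 k <= M
  | _ => true
  end.

Fixpoint safes (l : seq instr) (s : store) : Prop :=
  if l is J :: l' then safe J s /\ safes l' (eff J s) else True.

Inductive exec : cmd -> store -> nat -> store -> Prop :=
| exec_do l s : all simple l -> safes l s ->
    exec (Do l) s (size l) (effs l s)
| exec_seq c1 c2 s k1 s1 k2 s2 : exec c1 s k1 s1 -> exec c2 s1 k2 s2 ->
    exec (Seq c1 c2) s (k1 + k2) s2
| exec_last c r s k s1 : exec c s k s1 -> s1.1 r = 0 -> r <= 64 ->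
    exec (Loop c r) s k.+1 s1
| exec_again c r s k s1 k2 s2 : exec c s k s1 -> 0 < s1.1 r -> r <= 64 ->
    exec (Loop c r) s1 k2 s2 -> exec (Loop c r) s (k.+1 + k2) s2.

(** This is total correctness: termination within [N] counted instructions is part of the claim. *)
Definition wp (c : cmd) (N : nat) (s : store) (Q : store -> Prop) : Prop :=
  exists k s', [/\ k <= N, exec c s k s' & Q s'].

Lemma wp_weaken c N s (Q : store -> Prop) N' (Q' : store -> Prop) :
  N <= N' -> (forall s', Q s' -> Q' s') -> wp c N s Q -> wp c N' s Q'.
Proof.
move=> leN QQ' [k [s' [lek E Qs]]]; exists k, s'; split; auto.
exact: leq_trans leN.
Qed.

Lemma wp_do l s (Q : store -> Prop) :
  all simple l -> safes l s -> Q (effs l s) -> wp (Do l) (size l) s Q.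
Proof. by move=> hl hs hQ; exists (size l), (effs l s); split; try constructor. Qed.

Lemma wp_seq c1 c2 N1 N2 s Q :
  wp c1 N1 s (fun s1 => wp c2 N2 s1 Q) -> wp (Seq c1 c2) (N1 + N2) s Q.
Proof.
move=> [k1 [s1 [le1 E1 [k2 [s2 [le2 E2 HQ]]]]]].
by exists (k1 + k2), s2; split; [exact: leq_add | exact: exec_seq E1 E2 |].
Qed.

(** The invariant is indexed by the number of rounds left, which the counter must equal after each
    round; the extra unit per round pays for the jump. *)
Lemma wp_loop (Inv : nat -> store -> Prop) c r N i s (Q : store -> Prop) :
  r <= 64 -> Inv i.+1 s ->
  (forall j s1, Inv j.+1 s1 ->
     wp c N s1 (fun s2 => Inv j s2 /\ s2.1 r = j)) ->
  (forall s1, Inv 0 s1 -> Q s1) ->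
  wp (Loop c r) (i.+1 * N.+1) s Q.
Proof.
move=> hr Hs body HQ; elim: i s Hs => [|i IH] s Hs.
  have [k [s1 [lek E [H0 r0]]]] := body 0 s Hs.
  by exists k.+1, s1; split; [rewrite mul1n | exact: exec_last | exact: HQ].
have [k [s1 [lek E [H0 r0]]]] := body i.+1 s Hs.
have [k2 [s2 [lek2 E2 Q2]]] :=
  IH s1 H0.
exists (k.+1 + k2), s2; split => //.
  by rewrite mulSn; apply: leq_add.
by apply: exec_again E _ hr E2; rewrite r0.
Qed.

Hypothesis M_ge64 : 64 <= M.

Definition bounded (s : store) : Prop :=
  (forall r, s.1 r <= M) /\ all (fun v => v <= M) s.2.

Lemma bounded_eff I s : simple I -> safe I s -> bounded s -> bounded (eff I s).
Proof.
case: s => m u hI sI [/= bm bu].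
have updP i v r : v <= M -> upd m i v r <= M.
  by move=> hv; rewrite /upd; case: ifP.
case: I hI sI => //= [i c|i j k|i j k|i j k|i j k|i j|i j|i] _ hs;
  (split=> /= [r|] //; try exact: updP).
- by apply: updP; apply: leq_trans (leq_subr _ _) _.
- by apply: updP; apply: leq_trans (leq_div _ _) _.
- by apply: updP; case: u bu => //= v u /andP[].
- by case: u bu => //= v u /andP[].
Qed.

Lemma leq_bits a b : a <= b -> bits a <= bits b.
Proof. by move=> leab; rewrite /bits ltnS leq_trunc_log. Qed.

(** Three register accesses cost at most [6 * bits M], and schoolbook multiplication or division
    adds [bits M ^ 2]. *)
Definition unit_cost : nat := 7 * bits M ^ 2.

Lemma sum_cost a b c e :
  a <= 2 * bits M -> b <= 2 * bits M -> c <= 2 * bits M -> e <= bits M * bits M ->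
  a + b + c + e <= unit_cost.
Proof.
rewrite /unit_cost expnS expn1 => ha hb hc he.
have : bits M <= bits M * bits M by rewrite leq_pmulr.
lia.
Qed.

Lemma leq_acc i v : i <= M -> v <= M -> acc i v <= 2 * bits M.
Proof. by move=> hi hv; rewrite mul2n -addnn leq_add ?leq_bits. Qed.

Lemma leq_cost I l s w : simple I -> safe I s -> bounded s ->
  cost I (Config l s.1 s.2 w) <= unit_cost.
Proof.
move=> hI sI bs; have [/= bm' _] := bounded_eff hI sI bs.
case: s hI sI bs bm' => m u hI sI [/= bm bu] bm'.
have small i v : i <= 64 -> v <= M -> acc i v <= 2 * bits M.
    by move=> hi; apply: leq_acc; apply: leq_trans M_ge64.
have bmm j k : bits (m j) * bits (m k) <= bits M * bits M.
  by rewrite leq_mul ?leq_bits.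
(* The target register holds the written value, so a bound on the memory after the step bounds the
   result. *)
have res i v : (forall r, upd m i v r <= M) -> v <= M.
  by move=> /(_ i); rewrite /upd eqxx.
have weak a b c : a <= 2 * bits M -> b <= 2 * bits M -> c <= 2 * bits M ->
    a + b + c <= unit_cost.
  by move=> ha hb hc; rewrite -[_ + c]addn0; apply: sum_cost.
have weak1 a : a <= 2 * bits M -> a <= unit_cost.
  by move=> ha; rewrite -[a]addn0 -[a + 0]addn0; apply: weak.
case: I hI sI bm' => //= [i c|i j k|i j k|i j k|i j k|i j|i j|i] hI hs bm'.
- by apply/weak1/small.
- case/and3P: hI => hi hj hk.
  by apply: weak; apply: small => //; apply: res bm'.
- case/and3P: hI => hi hj hk.
  by apply: weak; apply: small => //; apply: res bm'.
- case/and3P: hI => hi hj hk.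
  by apply: sum_cost; rewrite ?bmm //; apply: small => //; apply: res bm'.
- case/and3P: hI => hi hj hk.
  by apply: sum_cost; rewrite ?bmm //; apply: small => //; apply: res bm'.
- by case/andP: hI => hi hj; apply: weak; [apply: small|apply: leq_acc|apply: small].
- by case/andP: hI => hi hj; apply: weak; [apply: small|apply: small|apply: leq_acc].
- by apply/weak1/small => //; apply: res bm'.
Qed.

(** * Correctness of compilation: from executions of commands to machine runs *)

Definition code_at (P : program) (l : nat) (cs : program) : Prop :=
  exists A B, P = A ++ cs ++ B /\ size A = l.

Lemma code_at_cat P l cs1 cs2 : code_at P l (cs1 ++ cs2) ->
  code_at P l cs1 /\ code_at P (l + size cs1) cs2.
Proof.
move=> [A [B [-> <-]]]; split; first by exists A, (cs2 ++ B); rewrite !catA.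
by exists (A ++ cs1), B; rewrite size_cat !catA.
Qed.

Lemma code_at_head P l I cs : code_at P l (I :: cs) ->
  onth P l = Some I /\ code_at P l.+1 cs.
Proof.
move=> H; have := H; rewrite -cat1s => /code_at_cat[_]; rewrite addn1; split=> //.
by have [A [B [-> <-]]] := H; rewrite onth_cat ltnn subnn.
Qed.

Lemma runs_do P l w t0 w' cs s : all simple cs -> safes cs s -> bounded s ->
  code_at P l cs ->
  runs P (Config (l + size cs) (effs cs s).1 (effs cs s).2 w) t0 w' ->
  bounded (effs cs s) /\ exists t, t <= size cs * unit_cost /\
    runs P (Config l s.1 s.2 w) (t + t0) w'.
Proof.
elim: cs l s => [|I cs IH] l s /=.
  by rewrite addn0 => _ _ bs _ hr; split=> //; exists 0.
move=> /andP[hI hcs] [sI scs] bs /code_at_head[hP hcode] hr.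
have bs' := bounded_eff hI sI bs.
rewrite addnS -addSn in hr.
have [be [t [let_ ht]]] := IH _ _ hcs scs bs' hcode hr.
split=> //; exists (cost I (Config l s.1 s.2 w) + t); split.
  by rewrite mulSn leq_add // leq_cost.
rewrite -addnA; apply: runs_step => //.
by move: ht; case: (I) hI {hP sI scs hr bs' be}.
Qed.

(** Induction on the execution, in continuation form: any run from the exit of the compiled code
    extends backwards to its entry, at a price of [unit_cost] per counted step. Absolute jump
    targets are right because the code sits at the address it was compiled for. *)
Lemma runs_compile c s k s' : exec c s k s' -> bounded s ->
  bounded s' /\ forall P l w t0 w', code_at P l (compile l c) ->
    runs P (Config (l + code_size c) s'.1 s'.2 w) t0 w' ->
    exists t, t <= k * unit_cost /\ runs P (Config l s.1 s.2 w) (t + t0) w'.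
Proof.
have jump P l0 l m u w t0 w' r : bounded (m, u) -> r <= 64 ->
    onth P l0 = Some (JumpPos r l) ->
    runs P (Config (if 0 < m r then l else l0.+1) m u w) t0 w' ->
    exists t, t <= unit_cost /\ runs P (Config l0 m u w) (t + t0) w'.
  move=> [/= bm _] hr hP hruns; exists (acc r (m r)); split; last first.
    exact: (@runs_step P (Config l0 m u w) _ t0 w' hP hruns).
  rewrite -[acc _ _]addn0 -[_ + 0]addn0 -[_ + 0]addn0.
  by apply: sum_cost => //; apply: leq_acc; rewrite // (leq_trans hr).
elim=> {c s k s'} [cs s hcs scs|c1 c2 s k1 s1 k2 s2 _ IH1 _ IH2
  |c r s k s1 _ IH r0 hr|c r s k s1 k2 s2 _ IH r0 hr _ IH2] bs.
- split; first last.
    move=> P l w t0 w' hcode hruns.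
    by have [_] := runs_do hcs scs bs hcode hruns.
  (* [runs_do] yields boundedness only when a run is supplied, so it is proved here by its own
     induction. *)
  have : forall s, all simple cs -> safes cs s -> bounded s -> bounded (effs cs s).
    elim: (cs) => //= I l IH s0 /andP[hI hl] [sI sl] bs0.
    exact: IH hl sl (bounded_eff hI sI bs0).
  exact.
- have [bs1 H1] := IH1 bs; have [bs2 H2] := IH2 bs1; split=> //.
  move=> P l w t0 w' /= /code_at_cat[]; rewrite size_compile addnA => h1 h2 hr.
  have [t2 [le2 R2]] := H2 _ _ _ _ _ h2 hr.
  have [t1 [le1 R1]] := H1 _ _ _ _ _ h1 R2.
  by exists (t1 + t2); rewrite mulnDl leq_add // -addnA.
- have [bs1 H1] := IH bs; split=> //.
  move=> P l w t0 w' /=; rewrite -cats1 => /code_at_cat[hc].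
  rewrite size_compile => /code_at_head[hj _] hruns.
  case: s1 {IH} r0 bs1 H1 hruns => m u /= r0 bs1 H1 hruns.
  have [|t2 [le2 R2]] := jump P _ l m u w t0 w' r bs1 hr hj.
    by rewrite r0 /= -addnS.
  have [t1 [le1 R1]] := H1 _ _ _ _ _ hc R2.
  by exists (t1 + t2); rewrite mulSn [unit_cost + _]addnC leq_add // -addnA.
- have [bs1 H1] := IH bs; have [bs2 H2] := IH2 bs1; split=> //.
  move=> P l w t0 w' hcode hruns.
  have [t3 [le3 R3]] := H2 _ _ _ _ _ hcode hruns.
  move: hcode => /=; rewrite -cats1 => /code_at_cat[hc].
  rewrite size_compile => /code_at_head[hj _].
  case: s1 {IH IH2 H2} r0 bs1 H1 R3 => m u /= r0 bs1 H1 R3.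
  have [|t2 [le2 R2]] := jump P _ l m u w (t3 + t0) w' r bs1 hr hj.
    by rewrite r0.
  have [t1 [le1 R1]] := H1 _ _ _ _ _ hc R2.
  exists (t1 + t2 + t3); split; last by rewrite -!addnA.
  by rewrite mulnDl mulSn [unit_cost + _]addnC !leq_add.
Qed.

End Bounded.

(** * Field elements as base-p numbers *)

Fixpoint axpy (n p R s V : nat) : nat :=
  if n is n'.+1 then
    axpy n' p R s V
    + ((R %/ p ^ n' %% p + s * (V %/ p ^ n' %% p)) %% p) * p ^ n'
  else 0.

(** Coefficients from index [n] on are dropped; this lets the modulus be stored without its leading
    term. *)
Definition enc (p n : nat) (r : {poly 'F_p}) : nat :=
  \sum_(i < n) (r`_i)%R * p ^ i.

Section Encoding.
Variables (p : nat) (p_prime : prime p).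

Let p_gt0 : 0 < p. Proof. exact: prime_gt0. Qed.

Lemma Fp_ltn (x : 'F_p) : x < p.
Proof. by have := ltn_ord x; rewrite [X in _ < X]Fp_cast. Qed.

Lemma Fp_natp : (p%:R = 0 :> 'F_p)%R.
Proof. by apply: ord_inj; rewrite val_Fp_nat ?modnn. Qed.

Lemma encS n (r : {poly 'F_p}) : enc n.+1 r = enc n r + (r`_n)%R * p ^ n.
Proof. by rewrite /enc big_ord_recr. Qed.

Lemma enc_lt n (r : {poly 'F_p}) : enc n r < p ^ n.
Proof.
elim: n => [|n IH]; first by rewrite /enc big_ord0.
have h := Fp_ltn (r`_n)%R; rewrite encS expnS.
apply: (@leq_trans ((r`_n)%R.+1 * p ^ n)); last by rewrite leq_mul2r h orbT.
by rewrite mulSn ltn_add2r.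
Qed.

Lemma enc_digit n (r : {poly 'F_p}) i : i < n ->
  enc n r %/ p ^ i %% p = (r`_i)%R.
Proof.
elim: n => // n IH; rewrite ltnS encS leq_eqVlt => /orP[/eqP ->|lt_in].
  rewrite addnC divnMDl ?expn_gt0 ?p_gt0 // divn_small ?enc_lt // addn0.
  by rewrite modn_small // Fp_ltn.
have -> : (r`_n)%R * p ^ n = (r`_n)%R * p ^ (n - i.+1) * p * p ^ i.
  by rewrite -!mulnA -expnS -expnD subnK.
by rewrite addnC divnMDl ?expn_gt0 ?p_gt0 // modnMDl IH.
Qed.

Lemma enc_inj n (r v : {poly 'F_p}) : size r <= n -> size v <= n ->
  enc n r = enc n v -> r = v.
Proof.
move=> sr sv e; apply/polyP => i.
have [lt_in|le_ni] := ltnP i n; last by rewrite !nth_default // (leq_trans _ le_ni).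
by apply: ord_inj; rewrite -!(enc_digit _ lt_in) e.
Qed.

Lemma coef_axpy (x y : 'F_p) s : (x + s%:R * y)%R = (x + s * y) %% p :> nat.
Proof.
by rewrite -(val_Fp_nat p_prime) natrD natrM; congr (nat_of_ord (_ + _ * _)%R);
  rewrite natr_Zp.
Qed.

Lemma enc_axpy n (r v : {poly 'F_p}) s :
  axpy n p (enc n r) s (enc n v) = enc n (r + s%:R *: v)%R.
Proof.
(* The recursion of [axpy] lowers the number of digits while both encodings keep length [n], so the
   two are separated before the induction. *)
suff axpyE m : m <= n ->
    axpy m p (enc n r) s (enc n v) = enc m (r + s%:R *: v)%R by exact: axpyE.
elim: m => [|m IH] ltmn /=; first by rewrite /enc big_ord0.
by rewrite encS IH 1?ltnW // !enc_digit // coefD coefZ coef_axpy.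
Qed.

Lemma encS_div n (r : {poly 'F_p}) : enc n.+1 r %/ p ^ n = (r`_n)%R.
Proof.
rewrite encS addnC divnMDl ?expn_gt0 ?p_gt0 // divn_small ?enc_lt // addn0.
by [].
Qed.

(** The shift pushes the top coefficient out of the window of [n.+1] digits, so that digit is
    removed before multiplying by [p]. *)
Lemma enc_mulX n (r : {poly 'F_p}) :
  enc n.+1 ('X * r)%R = (enc n.+1 r - (r`_n)%R * p ^ n) * p.
Proof.
rewrite [enc n.+1 r]encS addnK {1}/enc big_ord_recl coefXM /= mul0n add0n big_distrl /=.
by apply: eq_bigr => i _; rewrite coefXM /= expnSr mulnA.
Qed.

(** * Reduction modulo a monic polynomial *)

Section Modulus.
Variables (n : nat) (h : {poly 'F_p}).
Hypotheses (h_monic : h \is monic) (size_h : size h = n.+2).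

(** As [h] is monic, subtracting the top coefficient of [r] times [h] cancels the only term of too
    high degree. *)
Lemma rmodp_mulX (r : {poly 'F_p}) : size r <= n.+1 ->
  rmodp ('X * r) h = ('X * r + (p - (r`_n)%R)%:R *: h)%R.
Proof.
move=> sr; set t : 'F_p := (r`_n)%R.
(* The natural number [p - t] stands for [- t]; for [t = 0] it is [p], which vanishes in ['F_p]. *)
have -> : ((p - t)%:R : 'F_p)%R = (- t)%R.
  by rewrite natrB 1?ltnW ?Fp_ltn // natr_Zp Fp_natp sub0r.
have E : ('X * r)%R = (t%:P * h + ('X * r + (- t) *: h))%R.
  by rewrite mul_polyC addrCA -scalerDl subrr scale0r addr0.
rewrite {1}E rmodpD // rmodp_mull // add0r.
apply: rmodp_small.
rewrite size_h ltnS; apply/leq_sizeP => j lenj; rewrite coefD coefZ coefXM.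
case: j lenj => // j; rewrite ltnS leq_eqVlt => /orP[/eqP <-|ltnj] /=.
  have -> : (h`_n.+1 = 1)%R by move: (monicP h_monic); rewrite lead_coefE size_h.
  by rewrite mulr1 subrr.
by rewrite !nth_default ?mulr0 ?addr0 ?size_h // (leq_trans sr).
Qed.

Definition mulX_enc (v : nat) : nat :=
  axpy n.+1 p ((v - v %/ p ^ n * p ^ n) * p) (p - v %/ p ^ n) (enc n.+1 h).

(** The encodings omit the terms of degree [n.+1] of ['X * r] and of [h]; nothing is lost, as these
    cancel in the remainder. *)
Lemma mulX_encE (r : {poly 'F_p}) : size r <= n.+1 ->
  mulX_enc (enc n.+1 r) = enc n.+1 (rmodp ('X * r) h).
Proof.
by move=> sr; rewrite /mulX_enc rmodp_mulX // -enc_axpy encS_div -enc_mulX.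
Qed.

(** By linearity of the remainder, a product is accumulated from reduced multiples of [w] weighted
    by the digits of [u]. *)
Lemma rmodp_mul_sum (u w : {poly 'F_p}) : size u <= n.+1 ->
  rmodp (u * w) h = (\sum_(i < n.+1) u`_i *: rmodp ('X^i * w) h)%R.
Proof.
move=> su; rewrite -[u in LHS]coefK (poly_def (size u)) mulr_suml.
rewrite (big_ord_widen_cond n.+1 xpredT (fun i => (u`_i *: 'X^i * w)%R)) //.
rewrite big_mkcond /= rmodp_sum //.
apply: eq_bigr => i _; case: ltnP => [_|le]; last first.
  by rewrite nth_default // scale0r rmod0p.
by rewrite -scalerAl rmodpZ.
Qed.

Lemma size_rmodp r : size (rmodp r h) <= n.+1.
Proof.
rewrite -ltnS -size_h ltn_rmodpN0 //.
exact: monic_neq0.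
Qed.

Lemma rmodp_mulXn i (w : {poly 'F_p}) :
  (rmodp ('X * rmodp ('X^i * w) h) h = rmodp ('X^(i.+1) * w) h)%R.
Proof. by rewrite rmodp_mulmr // mulrA -exprS. Qed.

End Modulus.

End Encoding.

(** * Straight-line arithmetic *)

(* Symbolic execution of straight-line arithmetic: an association list of the
   registers written so far, over the initial memory [m]. *)
Fixpoint get (e : seq (nat * nat)) (m : nat -> nat) (r : nat) : nat :=
  if e is (i, v) :: e' then if eqn r i then v else get e' m r else m r.

Definition dest (J : instr) : nat :=
  match J with
  | Const i _ | Add i _ _ | Defs.Sub i _ _ | Mul i _ _ | Div i _ _ => i
  | _ => 0
  end.

Definition value (J : instr) (g : nat -> nat) : nat :=
  match J with
  | Const _ c => c
  | Add _ j k => g j + g k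
  | Defs.Sub _ j k => g j - g k
  | Mul _ j k => g j * g k
  | Div _ j k => g j %/ g k
  | _ => 0
  end.

Definition arith (J : instr) : bool :=
  match J with
  | Const _ _ | Add _ _ _ | Defs.Sub _ _ _ | Mul _ _ _ | Div _ _ _ => simple J
  | _ => false
  end.

Fixpoint sym (l : seq instr) (e : seq (nat * nat)) (m : nat -> nat) :=
  if l is J :: l' then sym l' ((dest J, value J (get e m)) :: e) m else e.

Fixpoint sym_safe (M : nat) (l : seq instr) (e : seq (nat * nat))
    (m : nat -> nat) : Prop :=
  if l is J :: l' then
    match J with
    | Const _ _ | Add _ _ _ | Mul _ _ _ => value J (get e m) <= M
    | _ => True
    end /\ sym_safe M l' ((dest J, value J (get e m)) :: e) m
  else True.

Definition same (L : seq nat) (s s' : store) : Prop :=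
  s'.2 = s.2 /\ forall r, r \notin L -> s'.1 r = s.1 r.

Lemma same_refl L s : same L s s. Proof. by []. Qed.

Lemma same_trans L1 L2 L s1 s2 s3 : same L1 s1 s2 -> same L2 s2 s3 ->
  all (mem L) L1 -> all (mem L) L2 -> same L s1 s3.
Proof.
move=> [e1 f1] [e2 f2] /allP a1 /allP a2; split; first by rewrite e2.
by move=> r rL; rewrite f2 ?f1 //; apply: contra rL; [apply: a1|apply: a2].
Qed.

Lemma value_ext J g g' : g =1 g' -> value J g = value J g'.
Proof. by move=> e; case: J => //= *; rewrite !e. Qed.

Lemma wp_arith M l L s (Q : store -> Prop) :
  all arith l -> all (fun J => dest J \in L) l -> sym_safe M l [::] s.1 ->
  (forall s', same L s s' -> (forall r, s'.1 r = get (sym l [::] s.1) s.1 r) ->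
     Q s') ->
  wp M (Do l) (size l) s Q.
Proof.
move=> al dl sl HQ.
(* [e] lists the writes made so far relative to the fixed initial store [s], so the induction runs
   over arbitrary [e] and current store. *)
have key : forall l e s', all arith l -> all (fun J => dest J \in L) l ->
    sym_safe M l e s.1 -> same L s s' -> (forall r, s'.1 r = get e s.1 r) ->
    safes M l s' /\ same L s (effs l s') /\
    (forall r, (effs l s').1 r = get (sym l e s.1) s.1 r).
  elim=> [|J l' IH] e s' //= /andP[aJ al'] /andP[dJ dl'] [sJ sl'] sm eq.
  have effE r : (eff J s').1 r = if eqn r (dest J) then value J s'.1 else s'.1 r.
    by case: J aJ {sl' dJ sJ}.
  have vE := value_ext J eq.
  have [||h1 [h2 h3]] := IH _ (eff J s') al' dl' sl'.
  - have [sm2 smr] := sm; split; first by rewrite -sm2; case: J aJ {sl' dJ sJ vE effE}.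
    move=> r rL; rewrite effE smr //.
    by case: eqnP => // er; rewrite er dJ in rL.
  - by move=> r; rewrite effE /= vE eq.
  split=> //; split=> //.
  by rewrite -vE in sJ; case: J aJ sJ {sl' dJ vE effE h1 h2 h3}.
have [h1 [h2 h3]] := key l [::] s al dl sl (same_refl L s) (fun r => erefl).
apply: wp_do => //; last exact: HQ.
by apply: sub_all al => -[].
Qed.

Ltac run := cbv [get sym sym_safe value dest eqn].

(** * The program *)

(* Registers of the program: 0 and 1 hold the constants 0 and 1; 2, 3, 4, 5
   hold p, n, q, p ^ n.-1; 6 holds h without its leading term and 7, ..., 11
   hold a, b, c, f, g, all as base-p numbers; 12, ..., 25 are the work space of
   the arithmetic; 26, ..., 34 belong to the two loops; 51 and 53 receive a
   solution (x, y + 1), while 50 and 52 absorb the writes of failed attempts;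
   the cell 64 + v of the table belongs to the field element of code v. *)
Definition axpy_body : program :=
  [:: Div 18 12 2; Mul 19 18 2; Defs.Sub 19 12 19; Defs.Sub 12 18 0;
      Div 18 14 2; Mul 20 18 2; Defs.Sub 20 14 20; Defs.Sub 14 18 0;
      Mul 20 13 20; Add 19 19 20; Div 18 19 2; Mul 18 18 2; Defs.Sub 19 19 18;
      Mul 19 19 17; Add 15 15 19; Mul 17 17 2; Defs.Sub 16 16 1].

(** Registers 12, 13, 14 hand over R, s, V and 15 returns the result; 16 counts the digits left and
    17 is the current power of p. Subtracting register 0 copies a register. *)
Definition axpy_cmd : cmd :=
  Seq (Do [:: Defs.Sub 16 3 0; Const 17 1; Const 15 0]) (Loop (Do axpy_body) 16).

(** The machine has no remainder instruction; this is how remainders are computed. *)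
Lemma sub_divM m d : m - m %/ d * d = m %% d.
Proof. by rewrite {1}(divn_eq m d) addKn. Qed.

Lemma axpy_lt n p R S V : 0 < p -> axpy n p R S V < p ^ n.
Proof.
move=> p_gt0; elim: n => //= n IH.
set c := (_ + _) %% p; have : c.+1 * p ^ n <= p ^ n.+1.
  by rewrite expnS leq_mul2r ltn_mod p_gt0 orbT.
by apply: leq_trans; rewrite mulSn ltn_add2r.
Qed.

(** * The digitwise linear combination as a machine routine *)

Section Routines.
Variables (p n q M : nat).
Hypotheses (p_gt0 : 0 < p) (n_gt0 : 0 < n) (qE : q = p ^ n)
  (M_ge : 4 * (q + 64) ^ 2 <= M).

Lemma fits v : v <= q + q * q -> v <= M.
Proof. by move=> hv; apply: leq_trans hv (leq_trans _ M_ge); clear; nia. Qed.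

Lemma fits_q v : v <= q -> v <= M.
Proof. by move=> hv; apply/fits/(leq_trans hv)/leq_addr. Qed.

Definition ready (s : store) : Prop :=
  [/\ s.1 0 = 0, s.1 1 = 1, s.1 2 = p & s.1 3 = n].

Lemma ready_same L s s' : ready s -> same L s s' ->
  0 \notin L -> 1 \notin L -> 2 \notin L -> 3 \notin L -> ready s'.
Proof. by move=> [? ? ? ?] [_ fr] *; split; rewrite fr. Qed.

Definition axpy_regs := [:: 12; 14; 15; 16; 17; 18; 19; 20].

(** The scalar may equal [p], since [p - t] with [t = 0] occurs in the reduction by [h]. A round
    takes 17 instructions and a jump. *)
Lemma wp_axpy s R S V : ready s -> s.1 12 = R -> s.1 13 = S -> s.1 14 = V ->
  R < q -> S <= p -> V < q ->
  wp M axpy_cmd (3 + n * 18) s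
    (fun s' => same axpy_regs s s' /\ s'.1 15 = axpy n p R S V).
Proof.
move=> rs s12 s13 s14 ltR leS ltV; have [s0 s1 s2 s3] := rs.
have le_pq : p <= q by rewrite qE -[p in p <= _]expn1 leq_pexp2l.
apply: wp_seq; apply: (@wp_arith _ _ axpy_regs); [by []|by []| |].
  run; split=> //; split=> //; apply: fits_q; exact: leq_trans le_pq.
move=> sa fra gta; rewrite -[n in n * _](prednK n_gt0).
(* With [j] digits left, the lowest [n - j] digits have been divided off both operands and assembled
   in register 15. *)
pose Inv j s' := [/\ same axpy_regs s s', s'.1 12 = R %/ p ^ (n - j),
  s'.1 14 = V %/ p ^ (n - j), s'.1 17 = p ^ (n - j) &
  s'.1 15 = axpy (n - j) p R S V /\ s'.1 16 = j /\ j <= n].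
apply: (wp_loop (Inv := Inv)) => //.
- rewrite prednK // /Inv subnn expn0 !divn1 !gta; run.
  by split=> //; rewrite s0 s3 subn0.
- move=> j s' [sm e12 e14 e17 [e15 [e16 lej]]].
  have [f0 f1 f2 f3] : ready s' by apply: ready_same rs sm _ _ _ _.
  have f13 : s'.1 13 = S by rewrite -s13; apply: sm.2.
  set i := n - j.+1 in e12 e14 e17 e15.
  have ei : n - j = i.+1 by rewrite /i subnSK.
  have lti : i < n by rewrite -ei leq_subr.
  have lepi : p ^ i.+1 <= q by rewrite qE leq_pexp2l.
  have axE : axpy i.+1 p R S V = axpy i p R S V +
    (R %/ p ^ i %% p + S * (V %/ p ^ i %% p)) %% p * p ^ i by [].
  have axlt := axpy_lt i.+1 R S V p_gt0.
  apply: (@wp_arith _ _ axpy_regs); [by []|by []| |].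
 rewrite /axpy_body;   run. rewrite f2 f13 e12 e14 e17 e15 !sub_divM -axE -expnSr.
    have lepi1 : p ^ i <= q by rewrite qE leq_pexp2l // ltnW.
    set X := R %/ p ^ i in axE *; set Y := V %/ p ^ i in axE *.
    have leX : X <= q by rewrite (leq_trans (leq_div _ _)) // ltnW.
    have leY : Y <= q by rewrite (leq_trans (leq_div _ _)) // ltnW.
    have leZ : X %% p + S * (Y %% p) <= q + q * q.
      rewrite leq_add ?leq_mul ?(leq_trans (leq_mod _ _) leX) //.
        exact: leq_trans le_pq.
      exact: leq_trans (leq_mod _ _) leY.
    have leA : axpy i.+1 p R S V <= q by rewrite ltnW // (leq_trans axlt).
    rewrite axE; repeat split=> //.
    + exact/fits_q/(leq_trans (leq_trunc_div _ _)).
    + exact/fits_q/(leq_trans (leq_trunc_div _ _)).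
    + exact/fits/(leq_trans (leq_addl _ _) leZ).
    + exact/fits.
    + exact/fits/(leq_trans (leq_trunc_div _ _)).
    + by apply: fits_q; apply: leq_trans leA; rewrite axE leq_addl.
    + by rewrite -axE; apply: fits_q.
    + exact: fits_q.
  move=> s3' sm3 gt3; have sm' : same axpy_regs s s3'.
    exact: same_trans sm sm3 _ _.
  rewrite /axpy_body in gt3; rewrite /Inv !gt3; run.
  rewrite f0 f1 f2 f13 e12 e14 e17 e15 e16 !subn0 !sub_divM ei axE.
  by rewrite !expnSr !divnMA subn1; do !split=> //; apply: ltnW.
- by move=> s' [sm _ _ _ []]; rewrite subn0.
Qed.

End Routines.

(** * Multiplication modulo [h] as a machine routine *)

Section FieldOps.
Variables (p k q M : nat) (h : {poly 'F_p}).
Hypotheses (p_prime : prime p) (qE : q = p ^ k.+1)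
  (M_ge : 4 * (q + 64) ^ 2 <= M) (h_monic : h \is monic)
  (size_h : size h = k.+2).

Let p_gt0 : 0 < p. Proof. exact: prime_gt0. Qed.

Definition mul_regs := [:: 12; 13; 14; 15; 16; 17; 18; 19; 20; 21; 22; 23; 24; 25].

Definition field_ready (s : store) : Prop :=
  [/\ ready p k.+1 s, s.1 5 = p ^ k & s.1 6 = enc k.+1 h].

Lemma field_ready_same L s s' : field_ready s -> same L s s' ->
  all (fun r => r \notin L) [:: 0; 1; 2; 3; 5; 6] -> field_ready s'.
Proof.
move=> [rs s5 s6] sm /and5P[n0 n1 n2 n3 /and3P[n5 n6 _]].
split; first exact: ready_same rs sm n0 n1 n2 n3.
  by rewrite -s5; apply: sm.2.
by rewrite -s6; apply: sm.2.
Qed.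

(** In each round this part splits off the next digit of the factor in 21 and prepares adding that
    multiple of 22 to the sum in 23; [mul_mid] saves the sum and prepares multiplying 22 by X, and
    [mul_post] saves the outcome. *)
Definition mul_pre : program :=
  [:: Div 25 21 2; Mul 13 25 2; Defs.Sub 13 21 13; Defs.Sub 21 25 0;
      Defs.Sub 12 23 0; Defs.Sub 14 22 0].
Definition mul_mid : program :=
  [:: Defs.Sub 23 15 0; Div 13 22 5; Mul 12 13 5; Defs.Sub 12 22 12;
      Mul 12 12 2; Defs.Sub 13 2 13; Defs.Sub 14 6 0].
Definition mul_post : program := [:: Defs.Sub 22 15 0; Defs.Sub 24 24 1].
Definition mul_cmd : cmd :=
  Seq (Do [:: Defs.Sub 24 3 0; Const 23 0])
    (Loop (Seq (Do mul_pre) (Seq axpy_cmd (Seq (Do mul_mid)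
       (Seq axpy_cmd (Do mul_post))))) 24).

Lemma enc_ltq (r : {poly 'F_p}) : enc k.+1 r < q.
Proof. by rewrite qE; apply: enc_lt. Qed.

Lemma mulX_wp s (r : {poly 'F_p}) : size r <= k.+1 -> ready p k.+1 s ->
  s.1 12 = (enc k.+1 r - enc k.+1 r %/ p ^ k * p ^ k) * p ->
  s.1 13 = p - enc k.+1 r %/ p ^ k -> s.1 14 = enc k.+1 h ->
  wp M axpy_cmd (3 + k.+1 * 18) s
    (fun s' => same axpy_regs s s' /\ s'.1 15 = enc k.+1 (rmodp ('X * r) h)).
Proof.
move=> sr rs s12 s13 s14.
apply: wp_weaken (wp_axpy p_gt0 (ltn0Sn k) qE M_ge rs s12 s13 s14 _ _ _) => //.
- by move=> s' []; split=> //; rewrite -(mulX_encE p_prime h_monic size_h).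
- by rewrite (encS_div p_prime) -enc_mulX enc_ltq.
- exact: leq_subr.
- exact: enc_ltq.
Qed.

Lemma wp_mul s (u w : {poly 'F_p}) : field_ready s ->
  s.1 21 = enc k.+1 u -> s.1 22 = enc k.+1 w ->
  size u <= k.+1 -> size w <= k.+1 ->
  wp M mul_cmd (2 + k.+1 * (k.+1 * 36 + 22)) s
    (fun s' => same mul_regs s s' /\ s'.1 23 = enc k.+1 (rmodp (u * w) h)).
Proof.
move=> fs s21 s22 su sw; have [[s0 s1 s2 s3] s5 s6] := fs.
have fq := fits_q M_ge.
apply: wp_seq; apply: (@wp_arith _ _ mul_regs); [by []|by []| |].
  by run; split=> //; split=> //; apply: fq.
move=> sa fra gta.
(* [Q] collects the partial sums of [rmodp_mul_sum], so [Q k.+1] is the reduced product. *)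
pose W i := rmodp ('X^i * w)%R h.
pose Q i := (\sum_(j < i) u`_j *: W j)%R.
pose Inv j s' := [/\ same mul_regs s s', s'.1 21 = enc k.+1 u %/ p ^ (k.+1 - j),
  s'.1 22 = enc k.+1 (W (k.+1 - j)), s'.1 23 = enc k.+1 (Q (k.+1 - j)) &
  s'.1 24 = j /\ j <= k.+1].
(* The 22 consists of two preambles of 3 instructions, 15 instructions around the two calls, and the
   jump. *)
have -> : k.+1 * 36 + 22 =
    (size mul_pre + ((3 + k.+1 * 18) + (size mul_mid + ((3 + k.+1 * 18)
      + size mul_post)))).+1.
  by rewrite /=; clear; lia.
apply: (wp_loop (Inv := Inv)) => //.
- rewrite /Inv subnn expn0 divn1 !gta; run; split=> //.
  + rewrite s22 /W expr0 mul1r rmodp_small //.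
    by rewrite size_h ltnS.
  + by rewrite /Q big_ord0 /enc big1 // => i _; rewrite coef0.
  + by rewrite s0 s3 subn0.
- move=> j s' [sm e21 e22 e23 [e24 lej]].
  have [[f0 f1 f2 f3] f5 f6] : field_ready s' by apply: field_ready_same fs sm _.
  set i := k.+1 - j.+1 in e21 e22 e23.
  have ei : k.+1 - j = i.+1 by rewrite /i subnSK.
  have lti : i < k.+1 by rewrite -ei leq_subr.
  apply: wp_seq; apply: (@wp_arith _ _ mul_regs); [by []|by []| |].
    rewrite /mul_pre; run; do !split=> //.
    by apply/fq/(leq_trans (leq_trunc_div _ _)); rewrite e21
       (leq_trans (leq_div _ _)) // ltnW // enc_ltq.
  rewrite /mul_pre => sb frb gtb.
  have smb : same mul_regs s sb by exact: same_trans sm frb _ _.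
  have fsb : field_ready sb by apply: field_ready_same fs smb _.
  have b12 : sb.1 12 = enc k.+1 (Q i) by rewrite gtb; run; rewrite f0 subn0.
  have b13 : sb.1 13 = (u`_i)%R.
    by rewrite gtb; run; rewrite f2 sub_divM e21 enc_digit.
  have b14 : sb.1 14 = enc k.+1 (W i) by rewrite gtb; run; rewrite f0 subn0.
  have b21 : sb.1 21 = enc k.+1 u %/ p ^ i.+1.
    by rewrite gtb; run; rewrite f0 subn0 f2 e21 expnSr divnMA.
  have b22 : sb.1 22 = enc k.+1 (W i) by rewrite gtb; run.
  have b24 : sb.1 24 = j.+1 by rewrite gtb; run.
  have [rb b5 b6] := fsb.
  have leu : (u`_i)%R <= p by rewrite ltnW // Fp_ltn.
  apply: wp_seq; apply: wp_weaken (wp_axpy p_gt0 (ltn0Sn k) qE M_ge rb b12 b13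
    b14 (enc_ltq _) leu (enc_ltq _)) => // sc [frc c15].
  have smc : same mul_regs s sc by exact: same_trans smb frc _ _.
  have [[c0 c1 c2 c3] c5 c6] : field_ready sc by apply: field_ready_same fs smc _.
  have c21 : sc.1 21 = enc k.+1 u %/ p ^ i.+1 by rewrite frc.2.
  have c22 : sc.1 22 = enc k.+1 (W i) by rewrite frc.2.
  have c24 : sc.1 24 = j.+1 by rewrite frc.2.
  have {}c15 : sc.1 15 = enc k.+1 (Q i.+1).
    rewrite c15 enc_axpy // natr_Zp /Q big_ord_recr //.
  have sW : size (W i) <= k.+1 by apply: size_rmodp.
  apply: wp_seq; apply: (@wp_arith _ _ mul_regs); [by []|by []| |].
    rewrite /mul_mid; run; rewrite c2 c5 c22; do !split=> //; apply/fq.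
      by apply: leq_trans (leq_trunc_div _ _) _; rewrite ltnW // enc_ltq.
    by rewrite (encS_div p_prime) -enc_mulX ltnW // enc_ltq.
  rewrite /mul_mid => sd frd gtd.
  have smd : same mul_regs s sd by exact: same_trans smc frd _ _.
  have [rd d5 d6] : field_ready sd by apply: field_ready_same fs smd _.
  apply: wp_seq; apply: wp_weaken (mulX_wp sW rd _ _ _) => //; first last.
  + by rewrite gtd; run; rewrite c0 subn0.
  + by rewrite gtd; run; rewrite c2 c5 c22.
  + by rewrite gtd; run; rewrite c2 c5 c22.
  move=> se [fre e15].
  have sme : same mul_regs s se by exact: same_trans smd fre _ _.
  have [[g0 g1 _ _] _ _] : field_ready se by apply: field_ready_same fs sme _.
  apply: (@wp_arith _ _ mul_regs); [by []|by []|by []|].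
  rewrite /mul_post => sf frf gtf.
  have smf : same mul_regs s sf by exact: same_trans sme frf _ _.
  rewrite /Inv ei !gtf; run.
  rewrite g0 g1 !subn0 e15 !fre.2 // !gtd; run.
  rewrite c0 subn0 c15 c21 c24 subn1 /W rmodp_mulXn //.
  by do !split=> //; apply: ltnW.
- move=> s' [sm _ _ s23 _]; split=> //; rewrite s23 subn0 /Q.
  by rewrite -(rmodp_mul_sum h_monic).
Qed.

End FieldOps.

(** The address is known only at run time, so indirect accesses fall outside the symbolic execution
    and are handled singly. *)
Lemma wp_fetch M i j s (Q : store -> Prop) : i <= 64 -> j <= 64 ->
  Q (upd s.1 i (s.1 (s.1 j)), s.2) -> wp M (Do [:: Fetch i j]) 1 s Q.
Proof. by move=> hi hj HQ; apply: (wp_do (l := [:: Fetch i j])) => //=; rewrite hi hj. Qed.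

Lemma wp_store M i j s (Q : store -> Prop) : i <= 64 -> j <= 64 ->
  Q (upd s.1 (s.1 i) (s.1 j), s.2) -> wp M (Do [:: Store i j]) 1 s Q.
Proof. by move=> hi hj HQ; apply: (wp_do (l := [:: Store i j])) => //=; rewrite hi hj. Qed.

Lemma wp_read M i s (Q : store -> Prop) : i <= 64 ->
  Q (upd s.1 i (head 0 s.2), behead s.2) -> wp M (Do [:: Read i]) 1 s Q.
Proof. by move=> hi HQ; apply: (wp_do (l := [:: Read i])) => //=; rewrite hi. Qed.

(** Unlike [same], this leaves the input tape free, as reading consumes it. *)
Definition frame (L : seq nat) (s s' : store) : Prop :=
  forall r, r \notin L -> s'.1 r = s.1 r.

Lemma frame_trans L1 L2 L s1 s2 s3 : frame L1 s1 s2 -> frame L2 s2 s3 ->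
  all (mem L) L1 -> all (mem L) L2 -> frame L s1 s3.
Proof.
move=> f1 f2 /allP a1 /allP a2 r rL.
by rewrite f2 ?f1 //; apply: contra rL; [apply: a1|apply: a2].
Qed.

Lemma frame_upd (L : seq nat) i v s u : i \in L -> frame L s (upd s.1 i v, u).
Proof. by move=> iL r rL; rewrite /= /upd; case: eqP rL => // ->; rewrite iL. Qed.

(** * Reading lists of coefficients from the input tape *)

Section Reading.
Variables (p k q M : nat).
Hypotheses (p_prime : prime p) (qE : q = p ^ k.+1)
  (M_ge : 4 * (q + 64) ^ 2 <= M).

Definition read_body : program :=
  [:: Mul 18 18 17; Add 15 15 18; Mul 17 17 2; Defs.Sub 16 16 1].
Definition read_cmd : cmd :=
  Seq (Do [:: Defs.Sub 16 3 0; Const 17 1; Const 15 0])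
    (Loop (Seq (Do [:: Read 18]) (Do read_body)) 16).
Definition read_regs := [:: 15; 16; 17; 18].

Lemma ready_frame L s s' : ready p k.+1 s -> frame L s s' ->
  all (fun r => r \notin L) [:: 0; 1; 2; 3] -> ready p k.+1 s'.
Proof.
by move=> [s0 s1 s2 s3] fr /and5P[n0 n1 n2 n3 _]; split; rewrite fr.
Qed.

Lemma wp_read_coeffs s (r : {poly 'F_p}) rest : ready p k.+1 s ->
  s.2 = coeffs k.+1 r ++ rest ->
  wp M read_cmd (3 + k.+1 * 6) s
    (fun s' => [/\ frame read_regs s s', s'.2 = rest & s'.1 15 = enc k.+1 r]).
Proof.
move=> rs su; have [s0 s1 s2 s3] := rs.
have fq := fits_q M_ge.
have q_gt0 : 0 < q by rewrite qE expn_gt0 prime_gt0.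
apply: wp_seq; apply: (@wp_arith _ _ read_regs); [by []|by []| |].
  by run; split=> //; split; [apply: fq|split=> //; apply: fq].
move=> sa [ua fra] gta.
pose digits i j := [seq nat_of_ord (r`_l)%R | l <- iota i j].
pose Inv j s' := [/\ frame read_regs s s', s'.2 = digits (k.+1 - j) j ++ rest,
  s'.1 15 = enc (k.+1 - j) r, s'.1 17 = p ^ (k.+1 - j) & s'.1 16 = j /\ j <= k.+1].
apply: (wp_loop (N := 5) (Inv := Inv)) => //.
- rewrite /Inv subnn expn0 !gta ua su; run; split=> //.
  + by rewrite /enc big_ord0.
  + by rewrite s0 s3 subn0.
- move=> j s' [sm eu e15 e17 [e16 lej]].
  have [f0 f1 f2 f3] : ready p k.+1 s' by apply: ready_frame rs sm _.
  set i := k.+1 - j.+1 in eu e15 e17.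
  have ei : k.+1 - j = i.+1 by rewrite /i subnSK.
  have lti : i < k.+1 by rewrite -ei leq_subr.
  apply: (wp_seq (N1 := 1) (N2 := 4)); apply: wp_read => //; rewrite eu /=.
  set sb := (_, _).
  have frb : frame read_regs s' sb by apply: frame_upd.
  have [b0 b1 b2 b3] : ready p k.+1 sb.
    by apply: ready_frame (frame_trans sm frb _ _) _.
  have b18 : sb.1 18 = (r`_i)%R by [].
  have b17 : sb.1 17 = p ^ i by exact: e17.
  have b15 : sb.1 15 = enc i r by exact: e15.
  have b16 : sb.1 16 = j.+1 by exact: e16.
  have ltS : enc i.+1 r <= q.
    by rewrite ltnW // (leq_trans (enc_lt p_prime _ _)) // qE leq_pexp2l ?prime_gt0.
  apply: (@wp_arith _ _ read_regs); [by []|by []| |].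
    rewrite /read_body; run; rewrite b18 b17 b15 b2 -expnSr.
    split; first by apply/fq/(leq_trans _ ltS); rewrite encS leq_addl.
    split; first by apply/fq; rewrite -encS.
    by do !split=> //; apply: fq; rewrite qE leq_pexp2l ?prime_gt0.
  rewrite /read_body => sc [uc frc] gtc.
  rewrite /Inv ei !gtc; run.
  rewrite b18 b17 b15 b2 b1 b16 subn1 -expnSr encS uc; do !split=> //.

  + by apply: frame_trans (frame_trans sm frb _ _) frc _ _.
  + exact: ltnW.
- by move=> s' [sm u e15 _ _]; rewrite u e15 subn0.
Qed.

End Reading.

(** Keeps the table, which begins at cell 64, apart from the work registers listed in frames. *)
Lemma addn64_notin (L : seq nat) v : all (fun r => r < 64) L -> v + 64 \notin L.
Proof. by move=> /allP aL; apply/negP => /aL; rewrite ltnNge leq_addl. Qed.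

Lemma frame_same L s s' : same L s s' -> frame L s s'.
Proof. by case. Qed.

(** * Tabulating [b * g ^ y] and searching along [a * f ^ x] *)

Section Solver.
Variables (p k q M : nat) (h : {poly 'F_p}) (hI : monic_irreducible_poly h).
Hypotheses (p_prime : prime p) (qE : q = p ^ k.+1)
  (M_ge : 4 * (q + 64) ^ 2 <= M) (size_h : size h = k.+2).
Local Notation F := {poly %/ h with hI}.
Variables (a b c f g : F).

Definition elt_code (x : F) : nat := enc k.+1 x.

Lemma size_elt (x : F) : size x <= k.+1.
Proof.
(* The quotient type reduces modulo [mk_monic h], which is [h] itself here. *)
have sz : size (mk_monic h) = k.+2 by rewrite mk_monicE.
by have := size_mk_monic x; rewrite [X in _ < X]sz.
Qed.

Lemma elt_code_inj : injective elt_code.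
Proof.
move=> x y exy; apply/val_inj.
exact: (enc_inj p_prime (size_elt x) (size_elt y) exy).
Qed.

Lemma elt_code_lt x : elt_code x < q.
Proof. by rewrite /elt_code (enc_ltq p_prime qE). Qed.

Lemma elt_code_mul (x y : F) :
  enc k.+1 (rmodp ((x : {poly 'F_p}) * (y : {poly 'F_p})) h) = elt_code (x * y)%R.
Proof.
have := poly_of_qpolyM x y; rewrite [X in rmodp _ X]mk_monicE // => e.
by rewrite /elt_code -[X in _ = enc _ X]/(val (x * y)%R) [val _]e.
Qed.

Lemma Fp_pred : ((p - 1)%:R = -1 :> 'F_p)%R.
Proof. by rewrite natrB ?prime_gt0 // Fp_natp // sub0r. Qed.

(** The scalar [p - 1] represents -1; the search forms [c - a * f ^ x] in this way. *)
Lemma elt_code_sub (x y : F) :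
  axpy k.+1 p (elt_code x) (p - 1) (elt_code y) = elt_code (x - y)%R.
Proof. by rewrite /elt_code enc_axpy // Fp_pred scaleN1r. Qed.

(** Register 30 holds the offset of the table, register 33 the scalar for subtraction. *)
Definition env (s : store) : Prop :=
  [/\ field_ready k h s, s.1 4 = q,
      [/\ s.1 7 = elt_code a, s.1 8 = elt_code b, s.1 9 = elt_code c, s.1 10 = elt_code f
        & s.1 11 = elt_code g], s.1 30 = 64 & s.1 33 = p - 1].

Definition pinned := [:: 0; 1; 2; 3; 4; 5; 6; 7; 8; 9; 10; 11; 30; 33].

Lemma env_frame L s s' : env s -> frame L s s' ->
  all (fun r => r \notin L) pinned -> env s'.
Proof.
move=> [[[s0 s1 s2 s3] s5 s6] s4 [s7 s8 s9 s10 s11] s30 s33] fr /allP n.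
by do !split; rewrite fr //; apply: n.
Qed.

(** Cells store [y.+1] so that zero can mean that no exponent below [Y] was entered; any exponent
    producing [x] is acceptable. *)
Definition table (Y : nat) (s : store) : Prop :=
  forall x : F,
    (s.1 (elt_code x + 64) = 0 /\ forall y, y < Y -> (b * g ^+ y)%R <> x) \/
    exists2 y, s.1 (elt_code x + 64) = y.+1 & (b * g ^+ y)%R = x.

Lemma table_frame L Y s s' : table Y s -> frame L s s' ->
  all (fun r => r < 64) L -> table Y s'.
Proof.
by move=> ts fr aL x; rewrite fr ?addn64_notin //; apply: ts.
Qed.

Let q_gt0 : 0 < q. Proof. by rewrite qE expn_gt0 prime_gt0. Qed.

Lemma fits_64 v : v <= q + 64 -> v <= M.
Proof.
move=> hv; apply: (leq_trans hv (leq_trans _ M_ge)).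
apply: (@leq_trans ((q + 64) ^ 2)); last exact: leq_pmull.
by rewrite -{1}[q + 64]expn1 leq_pexp2l // addn_gt0 orbT.
Qed.

(** Register 28 runs through the values [b * g ^ y], and 27 through the marks [y + 1], whence its
    initial value 1. *)
Definition table_body : cmd :=
  Seq (Do [:: Add 29 28 30])
   (Seq (Do [:: Store 29 27])
   (Seq (Do [:: Add 27 27 1; Defs.Sub 21 28 0; Defs.Sub 22 11 0])
   (Seq mul_cmd (Do [:: Defs.Sub 28 23 0; Defs.Sub 26 26 1])))).
Definition table_cmd : cmd :=
  Seq (Do [:: Defs.Sub 26 4 0; Const 27 1; Defs.Sub 28 8 0])
    (Loop table_body 26).
Definition loop_regs := [:: 26; 27; 28; 29] ++ mul_regs.

Definition mul_time := 2 + k.+1 * (k.+1 * 36 + 22).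

(** Codes are injective, so the write affects only the cell of [b * g ^ Y]; overwriting an older
    exponent there is harmless. *)
Lemma table_stored Y s s1 : table Y s -> frame loop_regs s s1 ->
  table Y.+1 (upd s1.1 (elt_code (b * g ^+ Y)%R + 64) Y.+1, s1.2).
Proof.
move=> ts fr x; have [exw|nxw] := eqVneq x (b * g ^+ Y)%R.
  by right; exists Y; rewrite /= /upd ?exw ?eqxx.
rewrite /= /upd eqn_add2r (inj_eq elt_code_inj) (negPf nxw) fr ?addn64_notin //.
have [[s0 none]|] := ts x; [left|by right]; split=> // y.
rewrite ltnS leq_eqVlt => /orP[/eqP ->|]; last exact: none.
by move/eqP: nxw => nxw /esym.
Qed.

Lemma wp_table s : env s -> s.1 53 = 0 ->
  (forall x : F, s.1 (elt_code x + 64) = 0) ->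
  wp M table_cmd (3 + q * (mul_time + 8)) s
    (fun s' => [/\ env s', table q s' & s'.1 53 = 0]).
Proof.
move=> es s53 s64; have [[[s0 _ _ _] _ _] s4 [_ s8 _ _ _] _ _] := es.
have fq := fits_q M_ge; have q0 := q_gt0.
apply: wp_seq; apply: (@wp_arith _ _ loop_regs); [by []|by []| |].
  by run; split=> //; split=> //; apply: fq.
move=> sa [_ fra] gta.
pose Inv j s' := [/\ env s', s'.1 26 = j /\ j <= q, s'.1 27 = (q - j).+1,
  s'.1 28 = elt_code (b * g ^+ (q - j))%R & table (q - j) s' /\ s'.1 53 = 0].
rewrite -{1}(prednK q0) [mul_time + 8](addnS _ 7).
apply: (wp_loop (N := mul_time + 7) (Inv := Inv)) => //.
- rewrite prednK // /Inv subnn mulr1 !gta; run.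
  split=> //; first exact: env_frame es fra _.
    by rewrite s0 s4 subn0.
    by rewrite s0 s8 subn0.
  split=> //.
  move=> x; left; split=> //; by rewrite fra ?s64 // addn64_notin.
- move=> j s' [es' [e26 lej] e27 e28 [ts e53]].
  have [_ _ _ f30 _] := es'.
  set i := q - j.+1 in e27 e28 ts.
  have ei : q - j = i.+1 by rewrite /i subnSK.
  have lti : i < q by rewrite -ei leq_subr.
  have -> : mul_time + 7 = 1 + (1 + (3 + (mul_time + 2))).
    by clear; lia.
  apply: wp_seq; apply: (@wp_arith _ [:: _] loop_regs); [by []|by []| |].
    run; split=> //; apply: fits_64.
    by rewrite f30 e28 leq_add2r ltnW // elt_code_lt.
  move=> s1 /frame_same fr1 gt1.
  have b29 : s1.1 29 = elt_code (b * g ^+ i)%R + 64 by rewrite gt1; run; rewrite e28 f30.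
  have b27 : s1.1 27 = i.+1 by rewrite gt1; run.
  have b28 : s1.1 28 = elt_code (b * g ^+ i)%R by rewrite gt1; run.
  have b26 : s1.1 26 = j.+1 by rewrite gt1; run.
  have t2 := table_stored ts fr1.
  apply: wp_seq; apply: wp_store => //; rewrite b29 b27.
  set s2 := (_, _) in t2 *.
  have low r : r < 64 -> s2.1 r = s1.1 r.
    by move=> lr; rewrite /= /upd ltn_eqF // (leq_trans lr) // leq_addl.
  have es1 : env s1 by apply: env_frame es' fr1 _.
  have es2 : env s2.
    move: es1 => [[[? ? ? ?] ? ?] ? [? ? ? ? ?] ? ?].
    by do !split; rewrite low.
  have [[[c0 c1 _ _] _ _] _ [_ _ _ _ c11] _ _] := es2.
  have c26 : s2.1 26 = j.+1 by rewrite low.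
  have c27 : s2.1 27 = i.+1 by rewrite low.
  have c28 : s2.1 28 = elt_code (b * g ^+ i)%R by rewrite low.
  have c53 : s2.1 53 = 0 by rewrite low // fr1.
  apply: wp_seq; apply: (@wp_arith _ [:: _; _; _] loop_regs); [by []|by []| |].
    run; split=> //; rewrite c1 c27; apply: fits_64.
    exact: leq_add.
  move=> s3 /frame_same fr3 gt3.
  have es3 : env s3 by apply: env_frame es2 fr3 _.
  have [fs3 _ _ _ _] := es3.
  have d21 : s3.1 21 = elt_code (b * g ^+ i)%R by rewrite gt3; run; rewrite c0 c28 subn0.
  have d22 : s3.1 22 = elt_code g by rewrite gt3; run; rewrite c0 c11 subn0.
  have d26 : s3.1 26 = j.+1 by rewrite gt3; run.
  have d27 : s3.1 27 = i.+2 by rewrite gt3; run; rewrite c1 c27 addn1.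
  apply: wp_seq; apply: wp_weaken (wp_mul p_prime qE M_ge hI.2
    size_h fs3 d21 d22 (size_elt _) (size_elt _)) => //.
  move=> s4' [/frame_same fr4]; rewrite elt_code_mul => e23.
  have es4 : env s4' by apply: env_frame es3 fr4 _.
  have [[[g0 g1 _ _] _ _] _ _ _ _] := es4.
  apply: (@wp_arith _ [:: _; _] loop_regs); [by []|by []|by []|].
  move=> s5 /frame_same fr5 gt5.
  have fr25 : frame loop_regs s2 s5.
    by apply: frame_trans (frame_trans fr3 fr4 _ _) fr5 _ _.
  have h26 : s5.1 26 = j by rewrite gt5; run; rewrite fr4 // d26 g1 subn1.
  rewrite /Inv ei; split=> //; split.
  + exact: env_frame es2 fr25 _.
  + by split; last exact: ltnW.
  + by rewrite gt5; run; rewrite fr4 // d27.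
  + by rewrite gt5; run; rewrite e23 g0 subn0 -mulrA -exprSr.
  + by split; [exact: table_frame t2 fr25 _|rewrite fr25].
- by move=> s' [es' _ _ _ []]; rewrite subn0.
Qed.

(** Register 53 follows the convention of the table: zero means no hit so far, in which case 51
    carries no meaning. *)
Definition found (X : nat) (s : store) : Prop :=
  (s.1 53 = 0 /\
     forall x y, x < X -> y < q -> (a * f ^+ x + b * g ^+ y)%R <> c) \/
  exists2 y, s.1 53 = y.+1 & (a * f ^+ (s.1 51) + b * g ^+ y)%R = c.

(** A nonzero cell at [c - a * f ^ X] yields a solution with this [X]; a zero cell excludes [X]
    together with every [y < q]. *)
Lemma found_next X s s' t : table q s -> found X s ->
  t = s.1 (elt_code (c - a * f ^+ X)%R + 64) ->
  s'.1 51 = (if 0 < t then X else s.1 51) ->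
  s'.1 53 = (if 0 < t then t else s.1 53) ->
  found X.+1 s'.
Proof.
move=> ts fs tE; have [[t0 none]|[y ty by_]] := ts (c - a * f ^+ X)%R; last first.
  rewrite tE ty /= => s51 s53; right; exists y; first by [].
  by rewrite s51 by_ addrC subrK.
rewrite tE t0 /= => s51 s53.
case: fs => [[e53 nosol]|[y ey sol]]; last by right; exists y; rewrite ?s51 // s53.
left; split; first by rewrite s53.
move=> x y; rewrite ltnS leq_eqVlt => /orP[/eqP -> ly|]; last exact: nosol.
by move=> sol; apply: (none y ly); rewrite -sol [(a * _ + _)%R]addrC addrK.
Qed.

(** A branch-free conditional write. If [t] is the cell looked up, [t %/ t] is 1 on a hit and 0
    otherwise, since division by 0 gives 0. Hence [x] goes to 51 or to the dummy 50, and [t] to 53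
    or to the dummy 52. *)
Definition search_body : cmd :=
  Seq (Do [:: Defs.Sub 12 9 0; Defs.Sub 13 33 0; Defs.Sub 14 28 0])
   (Seq axpy_cmd
   (Seq (Do [:: Add 29 15 30])
   (Seq (Do [:: Fetch 31 29])
   (Seq (Do [:: Div 32 31 31; Const 34 50; Add 32 32 34])
   (Seq (Do [:: Store 32 27])
   (Seq (Do [:: Const 34 2; Add 32 32 34])
   (Seq (Do [:: Store 32 31])
   (Seq (Do [:: Add 27 27 1; Defs.Sub 21 28 0; Defs.Sub 22 10 0])
   (Seq mul_cmd (Do [:: Defs.Sub 28 23 0; Defs.Sub 26 26 1])))))))))).
Definition search_cmd : cmd :=
  Seq (Do [:: Defs.Sub 26 4 0; Const 27 0; Defs.Sub 28 7 0])
    (Loop search_body 26).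
Definition search_regs := [:: 26; 27; 28; 29; 31; 32; 34] ++ mul_regs.

Definition search_time := 3 + ((3 + k.+1 * 18) + (1 + (1 + (3 + (1 + (2 +
  (1 + (3 + (mul_time + 2))))))))).

Lemma wp_search s : env s -> table q s -> s.1 53 = 0 ->
  wp M search_cmd (3 + q * search_time.+1) s
    (fun s' => env s' /\ found q s').
Proof.
move=> es ts s53; have [[[s0 _ _ _] _ _] s4 [s7 _ _ _ _] _ _] := es.
have fq := fits_q M_ge; have q0 := q_gt0.
apply: wp_seq; apply: (@wp_arith _ _ search_regs); [by []|by []| |].
  by run; do !split=> //; apply: fq.
move=> sa [_ fra] gta.
pose Inv j s' := [/\ env s', s'.1 26 = j /\ j <= q, s'.1 27 = q - j,
  s'.1 28 = elt_code (a * f ^+ (q - j))%R & table q s' /\ found (q - j) s'].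
rewrite -{1}(prednK q0).
apply: (wp_loop (Inv := Inv)) => //.
- rewrite prednK // /Inv subnn mulr1 !gta; run.
  split=> //; first exact: env_frame es fra _.
    by rewrite s0 s4 subn0.
    by rewrite s0 s7 subn0.
  split; first exact: table_frame ts fra _.
  by left; rewrite fra.
- move=> j s' [es' [e26 lej] e27 e28 [ts' fs']].
  have [[[f0 _ _ _] _ _] _ [_ _ f9 _ _] _ f33] := es'.
  set i := q - j.+1 in e27 e28 fs'.
  have ei : q - j = i.+1 by rewrite /i subnSK.
  have lti : i < q by rewrite -ei leq_subr.
  apply: wp_seq; apply: (@wp_arith _ [:: _; _; _] search_regs);
    [by []|by []|by []|].
  move=> s1 /frame_same fr1 gt1.
  have es1 : env s1 by apply: env_frame es' fr1 _.
  have b12 : s1.1 12 = elt_code c by rewrite gt1; run; rewrite f0 f9 subn0.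
  have b13 : s1.1 13 = p - 1 by rewrite gt1; run; rewrite f0 f33 subn0.
  have b14 : s1.1 14 = elt_code (a * f ^+ i)%R by rewrite gt1; run; rewrite f0 e28 subn0.
  have b26 : s1.1 26 = j.+1 by rewrite gt1; run.
  have b27 : s1.1 27 = i by rewrite gt1; run.
  have b28 : s1.1 28 = elt_code (a * f ^+ i)%R by rewrite gt1; run.
  have [[rs1 _ _] _ _ _ _] := es1.
  apply: wp_seq; apply: wp_weaken (wp_axpy (prime_gt0 p_prime) (ltn0Sn k) qE M_ge
    rs1 b12 b13 b14 (elt_code_lt _) (leq_subr _ _) (elt_code_lt _)) => //.
  move=> s2 [/frame_same fr2]; rewrite elt_code_sub => c15.
  have es2 : env s2 by apply: env_frame es1 fr2 _.
  have [_ _ _ c30 _] := es2.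
  apply: wp_seq; apply: (@wp_arith _ [:: _] search_regs); [by []|by []| |].
    by run; split=> //; apply: fits_64; rewrite c15 c30 leq_add2r ltnW // elt_code_lt.
  move=> s3 /frame_same fr3 gt3.
  have fr03 : frame search_regs s' s3.
    by apply: frame_trans (frame_trans fr1 fr2 _ _) fr3 _ _.
  have d29 : s3.1 29 = elt_code (c - a * f ^+ i)%R + 64.
    by rewrite gt3; run; rewrite c15 c30.
  have d26 : s3.1 26 = j.+1 by rewrite gt3; run; rewrite fr2.
  have d27 : s3.1 27 = i by rewrite gt3; run; rewrite fr2.
  have d28 : s3.1 28 = elt_code (a * f ^+ i)%R by rewrite gt3; run; rewrite fr2.
  apply: wp_seq; apply: wp_fetch => //; rewrite d29.
  set t := s3.1 _; set s4' := (_, _).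
  have tE : t = s'.1 (elt_code (c - a * f ^+ i)%R + 64).
    by rewrite /t fr03 // addn64_notin.
  have fr4 : frame [:: 31] s3 s4' by apply: frame_upd.
  have g31 : s4'.1 31 = t by [].
  have g27 : s4'.1 27 = i by rewrite fr4.
  apply: wp_seq; apply: (@wp_arith _ [:: _; _; _] [:: 32; 34]); [by []|by []| |].
    run; rewrite g31 divnn; do !split=> //; apply: fits_64;
      apply: leq_trans (leq_addl _ _) => //.
    by case: (0 < t).
  move=> s5 /frame_same fr5 gt5.
  have h32 : s5.1 32 = (0 < t) + 50 by rewrite gt5; run; rewrite g31 divnn.
  have h27 : s5.1 27 = i by rewrite gt5; run.
  have h31 : s5.1 31 = t by rewrite gt5; run.
  have fr35 : frame [:: 31; 32; 34] s3 s5 by apply: frame_trans fr4 fr5 _ _.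
  have fr05 : frame search_regs s' s5 by apply: frame_trans fr03 fr35 _ _.
  apply: wp_seq; apply: wp_store => //; rewrite h32 h27.
  set s6 := (_, _).
  have fr6 : frame [:: 50; 51] s5 s6.
    by apply: frame_upd; case: (0 < t).
  have i51 : s6.1 51 = if 0 < t then i else s'.1 51.
    by rewrite /= /upd -(fr05 51 isT); case: (0 < t).
  have i32 : s6.1 32 = (0 < t) + 50 by rewrite fr6.
  clearbody s6.
  apply: wp_seq; apply: (@wp_arith _ [:: _; _] [:: 32; 34]); [by []|by []| |].
    run; rewrite i32; do !split=> //; apply: fits_64;
      apply: leq_trans (leq_addl _ _) => //.
    by case: (0 < t).
  move=> s7' /frame_same fr7 gt7.
  have j32 : s7'.1 32 = (0 < t) + 52 by rewrite gt7; run; rewrite i32 -addnA.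
  have j31 : s7'.1 31 = t by rewrite fr7 // fr6.
  have j51 : s7'.1 51 = if 0 < t then i else s'.1 51 by rewrite fr7.
  have j53 : s7'.1 53 = s'.1 53 by rewrite fr7 // fr6 // fr05.
  apply: wp_seq; apply: wp_store => //; rewrite j32 j31.
  set s8 := (_, _).
  have fr8 : frame [:: 52; 53] s7' s8.
    by apply: frame_upd; case: (0 < t).
  have k53 : s8.1 53 = if 0 < t then t else s'.1 53.
    by rewrite -j53 /= /upd; case: (0 < t).
  have k51 : s8.1 51 = if 0 < t then i else s'.1 51 by rewrite fr8.
  clearbody s8.
  have fs8 : found i.+1 s8 by apply: found_next ts' fs' tE k51 k53.
  have fr38 : frame [:: 31; 32; 34; 50; 51; 52; 53] s3 s8.
    have fr36 : frame [:: 31; 32; 34; 50; 51] s3 s6.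
      exact: frame_trans fr35 fr6 _ _.
    have fr37 : frame [:: 31; 32; 34; 50; 51] s3 s7'.
      exact: frame_trans fr36 fr7 _ _.
    exact: frame_trans fr37 fr8 _ _.
  have fr08 : frame (search_regs ++ [:: 50; 51; 52; 53]) s' s8.
    by apply: frame_trans fr03 fr38 _ _.
  have es8 : env s8 by apply: env_frame es' fr08 _.
  have [[[l0 l1 _ _] _ _] _ [_ _ _ l10 _] _ _] := es8.
  have l26 : s8.1 26 = j.+1 by rewrite fr38.
  have l27 : s8.1 27 = i by rewrite fr38.
  have l28 : s8.1 28 = elt_code (a * f ^+ i)%R by rewrite fr38.
  apply: wp_seq; apply: (@wp_arith _ [:: _; _; _] search_regs); [by []|by []| |].
    run; split=> //; rewrite l1 l27; apply: fits_64.
    by apply: leq_add; first exact: ltnW.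
  move=> s9 /frame_same fr9 gt9.
  have es9 : env s9 by apply: env_frame es8 fr9 _.
  have [fs9 _ _ _ _] := es9.
  have m21 : s9.1 21 = elt_code (a * f ^+ i)%R by rewrite gt9; run; rewrite l0 l28 subn0.
  have m22 : s9.1 22 = elt_code f by rewrite gt9; run; rewrite l0 l10 subn0.
  have m26 : s9.1 26 = j.+1 by rewrite gt9; run.
  have m27 : s9.1 27 = i.+1 by rewrite gt9; run; rewrite l1 l27 addn1.
  apply: wp_seq; apply: wp_weaken (wp_mul p_prime qE M_ge hI.2
    size_h fs9 m21 m22 (size_elt _) (size_elt _)) => //.
  move=> s10 [/frame_same fr10]; rewrite elt_code_mul => n23.
  have es10 : env s10 by apply: env_frame es9 fr10 _.
  have [[[o0 o1 _ _] _ _] _ _ _ _] := es10.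
  apply: (@wp_arith _ [:: _; _] search_regs); [by []|by []|by []|].
  move=> s11 /frame_same fr11 gt11.
  have fr811 : frame search_regs s8 s11.
    by apply: frame_trans (frame_trans fr9 fr10 _ _) fr11 _ _.
  have h26 : s11.1 26 = j by rewrite gt11; run; rewrite fr10 // m26 o1 subn1.
  rewrite /Inv ei; split=> //; split.
  + exact: env_frame es8 fr811 _.
  + by split; last exact: ltnW.
  + by rewrite gt11; run; rewrite fr10 // m27.
  + by rewrite gt11; run; rewrite n23 o0 subn0 -mulrA -exprSr.
  + split; first exact: table_frame (table_frame ts' fr08 _) fr811 _.
    by move: fs8; rewrite /found !fr811.
- by move=> s' [es' _ _ _ []]; rewrite subn0.
Qed.

(** * Initialisation and the complete solver *)

Definition load (d : nat) : cmd := Seq read_cmd (Do [:: Defs.Sub d 15 0]).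

Lemma wp_load d s (r : {poly 'F_p}) rest : ready p k.+1 s ->
  s.2 = coeffs k.+1 r ++ rest -> d <= 64 ->
  wp M (load d) (3 + k.+1 * 6 + 1) s
    (fun s' => [/\ frame (d :: read_regs) s s', s'.2 = rest & s'.1 d = enc k.+1 r]).
Proof.
move=> rs su hd.
apply: wp_seq; apply: wp_weaken (wp_read_coeffs p_prime qE M_ge rs su) => //.
move=> s1 [fr1 u1 e15].
apply: (wp_do (l := [:: Defs.Sub d 15 0])); first by rewrite /= hd.
  by [].
have [f0 _ _ _] : ready p k.+1 s1 by apply: ready_frame rs fr1 _.
split=> //=; last by rewrite /upd eqxx f0 subn0.
move=> i; rewrite inE negb_or => /andP[nd nr] /=.
by rewrite /upd (negPf nd) fr1.
Qed.

Lemma coeffsS m (r : {poly 'F_p}) :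
  coeffs m.+1 r = coeffs m r ++ [:: nat_of_ord (r`_m)%R].
Proof. by rewrite /coeffs mkseqS cats1. Qed.

Definition init_cmd : cmd :=
  Seq (Do [:: Const 1 1]) (Seq (Do [:: Read 4]) (Seq (Do [:: Read 2])
   (Seq (Do [:: Read 3]) (Seq (Do [:: Div 5 4 2])
   (Seq (load 6) (Seq (Do [:: Read 18]) (Seq (load 7) (Seq (load 8)
   (Seq (load 9) (Seq (load 10) (Seq (load 11)
     (Do [:: Const 30 64; Defs.Sub 33 2 1])))))))))))).

Definition load_time := 3 + k.+1 * 6 + 1.
Definition init_time := 1 + (1 + (1 + (1 + (1 + (load_time + (1 + (load_time +
  (load_time + (load_time + (load_time + (load_time + 2))))))))))).
Definition init_store : store := (fun=> 0, encode_input q k.+1 a b c f g).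

(** Nothing from register 50 on is written, so the table and the result registers are still zero
    when tabulation starts. *)
Lemma wp_init : wp M init_cmd init_time init_store
  (fun s => env s /\ forall r, 50 <= r -> s.1 r = 0).
Proof.
have fq := fits_q M_ge; have q0 := q_gt0.
apply: wp_seq; apply: (@wp_arith _ [:: _] [:: 1]); [by []|by []| |].
  by run; split=> //; apply: fq.
move=> s1 [u1 fr1] gt1; have b1 : s1.1 1 = 1 by rewrite gt1.
apply: wp_seq; apply: wp_read => //; set s2 := (_, _).
have fr2 : frame [:: 4] s1 s2 by apply: frame_upd.
have c4 : s2.1 4 = q by rewrite /= u1.
have u2 : s2.2 = behead init_store.2 by rewrite /= u1.
clearbody s2; apply: wp_seq; apply: wp_read => //; set s3 := (_, _).
have fr3 : frame [:: 2] s2 s3 by apply: frame_upd.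
have d2 : s3.1 2 = p by rewrite /= u2.
have u3 : s3.2 = behead (behead init_store.2) by rewrite /= u2.
clearbody s3; apply: wp_seq; apply: wp_read => //; set s4 := (_, _).
have fr4 : frame [:: 3] s3 s4 by apply: frame_upd.
have e3 : s4.1 3 = k.+1 by rewrite /= u3.
have u4 : s4.2 = coeffs k.+1 h ++ [:: nat_of_ord (h`_k.+1)%R] ++
    coeffs k.+1 a ++ coeffs k.+1 b ++ coeffs k.+1 c ++ coeffs k.+1 f ++
    coeffs k.+1 g ++ [::].
  by rewrite -[s4.2]/(behead s3.2) u3 cats0 catA -coeffsS.
clearbody s4; apply: wp_seq; apply: (@wp_arith _ [:: _] [:: 5]);
  [by []|by []|by []|].
move=> s5 [u5 fr5] gt5.
have r5 : ready p k.+1 s5.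
  by split; rewrite fr5 // ?fr4 // ?fr3 // ?fr2 // ?fr1.
have f4 : s5.1 4 = q by rewrite fr5 // fr4 // fr3.
have f5 : s5.1 5 = p ^ k.
  rewrite gt5; run; rewrite fr4 // fr3 // c4 fr4 // d2 qE expnSr.
  by rewrite mulnK ?prime_gt0.
have high5 r : 6 <= r -> s5.1 r = 0.
  by case: r => [|[|[|[|[|[|r]]]]]] // _; rewrite fr5 ?fr4 ?fr3 ?fr2 ?fr1.
rewrite -{}u5 in u4; move: u4 => u5.
apply: wp_seq; apply: wp_weaken (wp_load r5 u5 _) => // s6 [fr6 u6 g6].
have r6 : ready p k.+1 s6 by apply: ready_frame r5 fr6 _.
(* The leading 1 of [h] comes next on the tape and is discarded into a scratch register. *)
apply: wp_seq; apply: wp_read => //; rewrite u6.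
set s7 := (_, _).
have fr7 : frame [:: 18] s6 s7 by apply: frame_upd.
have u7 : s7.2 = coeffs k.+1 a ++ coeffs k.+1 b ++ coeffs k.+1 c ++
  coeffs k.+1 f ++ coeffs k.+1 g ++ [::] by [].
clearbody s7; have r7 : ready p k.+1 s7 by apply: ready_frame r6 fr7 _.
apply: wp_seq; apply: wp_weaken (wp_load r7 u7 _) => // s8 [fr8 u8 g7].
have r8 : ready p k.+1 s8 by apply: ready_frame r7 fr8 _.
apply: wp_seq; apply: wp_weaken (wp_load r8 u8 _) => // s9 [fr9 u9 g8].
have r9 : ready p k.+1 s9 by apply: ready_frame r8 fr9 _.
apply: wp_seq; apply: wp_weaken (wp_load r9 u9 _) => // s10 [fr10 u10 g9].
have r10 : ready p k.+1 s10 by apply: ready_frame r9 fr10 _.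
apply: wp_seq; apply: wp_weaken (wp_load r10 u10 _) => // s11 [fr11 u11 g10].
have r11 : ready p k.+1 s11 by apply: ready_frame r10 fr11 _.
apply: wp_seq; apply: wp_weaken (wp_load r11 u11 _) => // s12 [fr12 u12 g11].
have r12 : ready p k.+1 s12 by apply: ready_frame r11 fr12 _.
apply: (@wp_arith _ [:: _; _] [:: 30; 33]); [by []|by []| |].
  by run; split=> //; apply: fits_64; apply: leq_addl.
move=> s13 /frame_same fr13 gt13.
have fr58 : frame [:: 6; 7; 15; 16; 17; 18] s5 s8.
  by apply: frame_trans (frame_trans fr6 fr7 (L := [:: 6; 15; 16; 17; 18]) _ _) fr8 _ _.
have fr810 : frame [:: 8; 9; 15; 16; 17; 18] s8 s10.
  exact: frame_trans fr9 fr10 _ _.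
have fr1012 : frame [:: 10; 11; 15; 16; 17; 18] s10 s12.
  exact: frame_trans fr11 fr12 _ _.
have fr1013 : frame [:: 10; 11; 15; 16; 17; 18; 30; 33] s10 s13.
  exact: frame_trans fr1012 fr13 _ _.
have fr813 : frame [:: 8; 9; 10; 11; 15; 16; 17; 18; 30; 33] s8 s13.
  exact: frame_trans fr810 fr1013 _ _.
split; last first.
  move=> r hr; rewrite fr813 ?fr58 ?high5 ?(leq_trans _ hr) //.
    by rewrite !inE !negb_or; repeat (apply/andP; split=> //); rewrite gtn_eqF // (leq_trans _ hr).
  by rewrite !inE !negb_or; repeat (apply/andP; split=> //); rewrite gtn_eqF // (leq_trans _ hr).
have r13 : ready p k.+1 s13 by apply: ready_frame r12 fr13 _.
do ?split=> //.
- by rewrite fr813 // fr58.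
- by rewrite fr813 // fr8 // fr7.
- by rewrite fr813 // fr58.
- by rewrite fr813.
- by rewrite fr13 // fr12 // fr11 // fr10.
- by rewrite fr13 // fr12 // fr11.
- by rewrite fr13 // fr12.
- by rewrite fr13.
- by rewrite gt13; run; have [_ -> -> _] := r12.
Qed.

Definition solver_cmd : cmd :=
  Seq init_cmd (Seq table_cmd (Seq search_cmd (Do [:: Defs.Sub 54 53 1]))).
Definition solver_time := init_time + ((3 + q * (mul_time + 8)) +
  ((3 + q * search_time.+1) + 1)).

Lemma wp_solver : wp M solver_cmd solver_time init_store
  (fun s => [/\ s.1 0 = 0, s.1 1 = 1, s.1 54 = s.1 53 - 1 & found q s]).
Proof.
apply: wp_seq; apply: wp_weaken wp_init => // s1 [es1 high].
have tab1 (x : F) : s1.1 (elt_code x + 64) = 0.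
  by apply: high; rewrite (leq_trans _ (leq_addl _ _)).
apply: wp_seq; apply: wp_weaken (wp_table es1 (high 53 isT) tab1) => //.
move=> s2 [es2 ts2 e53].
apply: wp_seq; apply: wp_weaken (wp_search es2 ts2 e53) => // s3 [es3 fs3].
have [[[f0 f1 _ _] _ _] _ _ _ _] := es3.
apply: (@wp_arith _ [:: _] [:: 54]); [by []|by []|by []|].
move=> s4 /frame_same fr gt; split; [by rewrite fr|by rewrite fr| |].
  by rewrite !gt; run; rewrite f1.
by move: fs3; rewrite /found !fr.
Qed.

Lemma leq_solver_time : solver_time <= 1000 * (q * (k.+1 * k.+1)).
Proof.
rewrite /solver_time /init_time /load_time /search_time /mul_time.
have := q_gt0; move: q; clear; set n := k.+1 => Q Q0.
have n0 : 0 < n by []; move: n n0 => n n0; nia.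
Qed.

(** * Exponents below [q] suffice *)

Hypothesis g_neq0 : (g != 0)%R.
Hypothesis f_neq0 : (f != 0)%R.

(** The field has [q] elements, so [x ^ q = x]; cancelling [x] shows that exponents matter only
    modulo [q - 1]. *)
Lemma exp_reduce (x : F) i : (x != 0)%R -> exists2 j, j < q & (x ^+ j = x ^+ i)%R.
Proof.
move=> x0; have cF : #|{: F}| = q.
  by rewrite card_qfpoly card_Fp // size_h qE.
have q1 : 1 < q by rewrite qE -{1}(expn0 p) ltn_exp2l ?prime_gt1.
have x1 : (x ^+ q.-1 = 1)%R.
  apply: (mulfI x0); rewrite mulr1 -exprS prednK ?(ltnW q1) // -cF.
  exact: expf_card.
exists (i %% q.-1).
  by rewrite (leq_trans (ltn_pmod _ _)) ?leq_pred // -ltnS prednK // ltnW.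
by rewrite [in RHS](divn_eq i q.-1) exprD mulnC exprM x1 expr1n mul1r.
Qed.

Lemma found_correct s : found q s ->
  correct_answer a b c f g
    (if 0 < s.1 53 then Some (s.1 51, s.1 53 - 1) else None).
Proof.
case=> [[-> none] /=|[y -> sol] /=]; last by rewrite subn1.
move=> [x [y sol]]; have [x' lx ex] := exp_reduce x f_neq0.
have [y' ly ey] := exp_reduce y g_neq0.
by apply: (none x' y'); rewrite // ex ey.
Qed.

End Solver.

(** * Writing the answer *)

Lemma runs_step_le M P s J N w : onth P (pc s) = Some J -> cost J s <= unit_cost M ->
  (exists t, t <= N * unit_cost M /\ runs P (step J s) t w) ->
  exists t, t <= N.+1 * unit_cost M /\ runs P s t w.
Proof.
move=> hP hc [t [ht hr]]; exists (cost J s + t); split; last exact: runs_step.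
by rewrite mulSn leq_add.
Qed.

(** Registers 0 and 1 supply the tags 0 and 1. The jump on register 1 is always taken; its target
    [l + 6] lies just past the code, where the machine halts. *)
Definition output_code (l : nat) : program :=
  [:: JumpPos 53 (l + 3); Write 0; JumpPos 1 (l + 6); Write 1; Write 51; Write 54].

Lemma runs_output M A s : 64 <= M -> bounded M s ->
  s.1 0 = 0 -> s.1 1 = 1 -> s.1 54 = s.1 53 - 1 ->
  exists t, t <= 4 * unit_cost M /\
    runs (A ++ output_code (size A)) (Config (size A) s.1 s.2 [::]) t
      (encode_answer (if 0 < s.1 53 then Some (s.1 51, s.1 53 - 1) else None)).
Proof.
move=> M_ge64 [bm _] s0 s1 s54.
have at_ i : onth (A ++ output_code (size A)) (size A + i) =
    onth (output_code (size A)) i.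
  by rewrite onth_cat ltnNge leq_addr /= addKn.
have acc_le i : i <= 64 -> acc i (s.1 i) <= unit_cost M.
  move=> hi; rewrite -[acc _ _]addn0 -[_ + 0]addn0 -[_ + 0]addn0.
  by apply: sum_cost => //; apply: leq_acc; rewrite // (leq_trans hi).
set P := A ++ _ in at_ *; set l := size A in at_ *.
have write r i w N w' : onth (output_code l) i = Some (Write r) -> r <= 64 ->
    (exists t, t <= N * unit_cost M /\
      runs P (Config (l + i.+1) s.1 s.2 (rcons w (s.1 r))) t w') ->
    exists t, t <= N.+1 * unit_cost M /\ runs P (Config (l + i) s.1 s.2 w) t w'.
  rewrite -at_ addnS => hP hr hrun.
  apply: (runs_step_le (s := Config (l + i) s.1 s.2 w) hP) hrun; exact: acc_le.
have jump r l' i w N w' : onth (output_code l) i = Some (JumpPos r l') -> r <= 64 ->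
    (exists t, t <= N * unit_cost M /\
      runs P (Config (if 0 < s.1 r then l' else l + i.+1) s.1 s.2 w) t w') ->
    exists t, t <= N.+1 * unit_cost M /\ runs P (Config (l + i) s.1 s.2 w) t w'.
  rewrite -at_ addnS => hP hr hrun.
  apply: (runs_step_le (s := Config (l + i) s.1 s.2 w) hP) hrun; exact: acc_le.
have halt w N : exists t, t <= N * unit_cost M /\
    runs P (Config (l + 6) s.1 s.2 w) t w.
  by exists 0; split=> //; apply: (@runs_halt P (Config _ _ _ _)); rewrite [pc _]/= at_.
rewrite -[X in Config X]addn0; apply: (jump) => //.
case: (ltnP 0 (s.1 53)) => [pos|]; last rewrite leqn0 => /eqP z.
  do 3! (apply: (write) => //).
  by rewrite s1 s54; apply: halt.
apply: (write) => //; apply: (jump) => //; rewrite s1 s0.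
exact: halt.
Qed.

(** * Bounds in terms of [q] and the final estimate *)

Lemma bits_expn q e : 1 < q -> 0 < e -> bits (q ^ e) <= e * bits q.
Proof.
move=> q1 e0; rewrite /bits.
have lt1 : q ^ e < 2 ^ (e * (trunc_log 2 q).+1).
  by rewrite mulnC expnM ltn_exp2r // trunc_log_ltn.
have le1 : 2 ^ trunc_log 2 (q ^ e) <= q ^ e.
  by apply: trunc_logP; rewrite // expn_gt0 ltnW.
by have := leq_ltn_trans le1 lt1; rewrite ltn_exp2l.
Qed.

(** For [q >= 2] one has [q + 64 <= 33 * q], and [4 * 33 ^ 2 <= 2 ^ 14 <= q ^ 14]. *)
Lemma bound_ge q : 1 < q -> 4 * (q + 64) ^ 2 <= q ^ 16.
Proof.
move=> q1; have le33 : q + 64 <= 33 * q by move: q q1; clear; lia.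
have le14 : 2 ^ 14 <= q ^ 14 by rewrite leq_exp2r.
have le2 : (q + 64) ^ 2 <= (33 * q) ^ 2 by rewrite leq_exp2r.
rewrite (expnD q 14 2) (leq_trans (n := 2 ^ 14 * q ^ 2)) //; last first.
  by rewrite leq_mul2r le14 orbT.
apply: leq_trans (leq_mul (leqnn 4) le2) _.
by rewrite expnMn mulnA leq_mul2r orbT.
Qed.

Definition solver : program :=
  compile 0 solver_cmd ++ output_code (code_size solver_cmd).

Section Solving.
Variables (q p k : nat) (h : {poly 'F_p}) (hI : monic_irreducible_poly h).
Hypotheses (p_prime : prime p) (qE : q = p ^ k.+1) (size_h : size h = k.+2).
Variables (a b c f g : {poly %/ h with hI}).
Hypotheses (f_neq0 : (f != 0)%R) (g_neq0 : (g != 0)%R).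

Lemma solver_correct : exists r t,
  [/\ computes_in solver (encode_input q k.+1 a b c f g) (encode_answer r) t,
      correct_answer a b c f g r
    & t <= 2000 * (7 * 32 ^ 2) * (q * trunc_log 2 q ^ 4)].
Proof.
have p_gt1 := prime_gt1 p_prime.
have lt_nq : k.+1 < q by rewrite qE ltn_expl.
have q_gt1 : 1 < q by apply: leq_ltn_trans lt_nq.
(* The degree is at most logarithmic because [2 ^ k.+1 <= p ^ k.+1 = q]. *)
have le_nl : k.+1 <= trunc_log 2 q.
  by apply: trunc_log_max => //; rewrite qE leq_exp2r.
have [M [M_ge le_qM bitsM]] : exists M,
    [/\ 4 * (q + 64) ^ 2 <= M, q <= M & bits M <= 16 * bits q].
  exists (q ^ 16); split; [exact: bound_ge| |exact: bits_expn].
  by rewrite -{1}[q]expn1 leq_pexp2l // ltnW.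
have M_ge64 : 64 <= M by exact: (fits_64 M_ge (leq_addl q 64)).
have leM v : v <= q -> v <= M by move=> /leq_trans ->.
have le_pq : p <= q by rewrite qE -{1}[p]expn1 leq_pexp2l // ltnW.
have bs : bounded M (init_store k q a b c f g).
  have bc m (r : {poly 'F_p}) : all (fun v => v <= M) (coeffs m r).
    apply/allP => v /mapP[i _ ->]; apply: leM; apply: leq_trans le_pq.
    by rewrite ltnW // Fp_ltn.
  split=> //; change (all (fun v => v <= M) (encode_input q k.+1 a b c f g)).
  rewrite /encode_input !all_cat !bc.
  by rewrite /= le_qM (leM _ le_pq) (leM _ (ltnW lt_nq)).
have [N [s [leN E [s0 s1 s54 fs]]]] :=
  wp_solver p_prime qE M_ge size_h a b c f g.
have [bs' comp] := runs_compile M_ge64 E bs.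
have [t1 [le1 R1]] := runs_output (compile 0 solver_cmd) M_ge64 bs' s0 s1 s54.
have at0 : code_at solver 0 (compile 0 solver_cmd).
  by exists [::], (output_code (code_size solver_cmd)).
rewrite size_compile -[X in Config X]add0n in R1.
have [t2 [le2 R2]] := comp _ _ _ _ _ at0 R1.
exists (if 0 < s.1 53 then Some (s.1 51, s.1 53 - 1) else None), (t2 + t1).
split.
- exact: R2.
- exact: (found_correct p_prime qE size_h g_neq0 f_neq0 fs).
have leT := leq_trans leN (leq_solver_time p_prime qE).
set l := trunc_log 2 q in le_nl *; have l_gt0 : 0 < l by apply: leq_trans le_nl.
(* Here [bits M <= 16 * (l + 1) <= 32 * l]. *)
have leU : unit_cost M <= 7 * 32 ^ 2 * l ^ 2.
  rewrite /unit_cost -mulnA -expnMn leq_mul2l /= leq_exp2r //.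
  apply: leq_trans bitsM _; rewrite -[32]/(16 * 2) -mulnA leq_mul2l /=.
  by rewrite /bits -/l mul2n -addnn -addn1 leq_add2l.
(* The 4 accounts for the output code. *)
have leN4 : N + 4 <= 2000 * (q * l ^ 2).
  have leNl : N <= 1000 * (q * l ^ 2).
    apply: leq_trans leT _; rewrite !leq_mul2l /= expnS expn1.
    by rewrite (leq_mul le_nl le_nl) orbT.
  have le4 : 4 <= 1000 * (q * l ^ 2).
    by rewrite -[4]muln1 leq_mul // muln_gt0 expn_gt0 l_gt0 (ltnW q_gt1).
  apply: leq_trans (leq_add leNl le4) _.
  by rewrite -mulnDl leq_mul2r orbT.
apply: leq_trans (leq_add le2 le1) _.
rewrite -mulnDl; apply: leq_trans (leq_mul leN4 leU) _.
by rewrite [l ^ 4](expnD l 2 2) mulnACA [q * (_ * _)]mulnA.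
Qed.

End Solving.

Unset Implicit Arguments.
Local Open Scope ring_scope.

Theorem theorem1 (R : realType) :
  exists (P : program) (C : R) (k : nat),
    forall (q p n : nat) (h : {poly 'F_p}) (hI : monic_irreducible_poly h)
      (a b c f g : {poly %/ h with hI}),
      prime p -> q = (p ^ n)%N -> size h = n.+1 ->
      a != 0 -> b != 0 -> c != 0 -> f != 0 -> g != 0 ->
      exists (r : option (nat * nat)) (t : nat),
        [/\ computes_in P (encode_input q n a b c f g) (encode_answer r) t,
            correct_answer a b c f g r
          & t%:R <= C * q%:R `^ (9 / 8) * ln q%:R ^+ k].
Proof.
(* The large constant is kept abstract so that it is never expanded in unary. *)
have [D DE] : exists D, D = (2000 * (7 * 32 ^ 2))%N by eexists.
(* The factor [ln 2 ^+ 4] converts four binary logarithms into natural ones. Degree 0 is excluded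
   because an irreducible polynomial is not constant. *)
exists solver, (D%:R / ln 2 ^+ 4), 4%N => q p [|n] h hI a b c f g p_prime qE size_h.
  by have := hI.1.1; rewrite size_h.
move=> _ _ _ f_neq0 g_neq0.
have [r [t [run_ correct]]] :=
  solver_correct p_prime qE size_h a b c f_neq0 g_neq0.
rewrite -DE => le_t; exists r, t; split=> //.
set l := trunc_log 2 q in le_t.
have q_gt0 : (0 < q)%N by rewrite qE expn_gt0 prime_gt0.
have ln2_gt0 : 0 < ln 2 :> R by rewrite ln_gt0 // ltr1n.
have q_ge1 : 1 <= q%:R :> R by rewrite ler1n.
have le_q : q%:R <= q%:R `^ (9 / 8) :> R.
  rewrite -{1}[q%:R]powRr1 ?ler0n // ler_powR //.
  by rewrite ler_pdivlMr ?ltr0n // mul1r ler_nat.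
(* This is [2 ^ l <= q] after taking logarithms. *)
have le_l : l%:R * ln 2 <= ln q%:R :> R.
  rewrite mulr_natl -lnXn ?ltr0n // ler_ln ?posrE ?exprn_gt0 ?ltr0n //.
  by rewrite -natrX ler_nat trunc_logP.
have -> : D%:R / ln 2 ^+ 4 * q%:R `^ (9 / 8) * ln q%:R ^+ 4 =
    D%:R * (q%:R `^ (9 / 8) * (ln q%:R / ln 2) ^+ 4) :> R.
  by rewrite expr_div_n; ring.
apply: (@Order.POrderTheory.le_trans _ _ (D * (q * l ^ 4))%:R); first by rewrite ler_nat.
rewrite natrM ler_wpM2l ?ler0n // natrM natrX ler_pM ?exprn_ge0 ?ler0n //.
by rewrite lerXn2r ?nnegrE ?ler0n ?divr_ge0 ?ln_ge0 ?ler1n // ler_pdivlMr.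
Qed.
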